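(* The class $\mathcal{F}_{cc}$ is a Ramsey class, that is, for every integer $r\ge 2$ and for all $S,T\in\mathcal{F}_{cc}$ with ${T\choose S}\ne\emptyset$ there exists $U\in\mathcal{F}_{cc}$ such that for every colouring $e:{U\choose S}\to\{1,2,\dots,r\}$ there is $g\in{U\choose T}$ such that $\{h\circ g: h\in{T\choose S}\}$ is monochromatic.
   Context: A fan is an undirected connected simple graph with all loops and with no cycles of length greater than one, with a distinguished point called the root, such that all elements other than the root have degree at most 2 (loops not counted). On a fan $T$, $s\preceq_T t$ iff $s$ lies on the path connecting $t$ and the root; $t$ is an immediate successor of $s$ if $s\preceq_T t$, $s\neq t$ and there is no $p\ne s,t$ with $s\preceq_T p\preceq_T t$. $R^T(s,t)$ holds iff $s=t$ or $t$ is an immediate successor of $s$. A branch is a maximal $\preceq_T$-linearly ordered subset; a branch with $n+1$ elements has height $n$. $\mathcal{F}$ is the family of all finite fans. For finite fans $A,B$, an epimorphism $\phi:B\to A$ is a surjection such that $R^A(x_1,x_2)$ iff there are $y_1,y_2\in B$ with $\phi(y_i)=x_i$ and $R^B(y_1,y_2)$ (equivalently, a surjection with $R^B(y_1,y_2)\Rightarrow R^A(\phi(y_1),\phi(y_2))$). A chain on $A\in\mathcal{F}$ is a family of nonempty subsets of $A$ pairwise comparable under inclusion; it is downwards closed if each member $C$ is downwards closed ($x\preceq_A y\in C\Rightarrow x\in C$), and downwards closed maximal if no further nonempty downwards closed set can be added. $\mathcal{F}_c$ is the family of pairs $(A,\mathcal{C}^A)$ with $A\in\mathcal{F}$ and $\mathcal{C}^A$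 a downwards closed maximal chain on $A$. A map $f:(B,\mathcal{C}^B)\to(A,\mathcal{C}^A)$ is an epimorphism if $f:B\to A$ is an epimorphism and $f(C)\in\mathcal{C}^A$ for every $C\in\mathcal{C}^B$. The chain $\mathcal{C}^A$ is canonical on $A$ (with root $v_A$) if for some ordering $b_1<\dots<b_n$ of the branches of $A$, whenever $C\in\mathcal{C}^A$ and $C\cap(b_j\setminus\{v_A\})\neq\emptyset$, then $b_i\subset C$ for every $1\le i<j\le n$. $\mathcal{F}_{cc}$ is the family of all $(A,\mathcal{C}^A)\in\mathcal{F}_c$ such that $\mathcal{C}^A$ is canonical and all branches of $A$ have the same height. For $A,B\in\mathcal{F}_{cc}$, ${B\choose A}$ denotes the set of all epimorphisms from $B$ onto $A$. *)

(* Defs.v *)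
From HB Require Import structures.
From mathcomp Require Import all_boot.
From mathcomp Require Import boolp.

Set Implicit Arguments.
Unset Strict Implicit.
Unset Printing Implicit Defensive.

(* All loops are present, so the cycles excluded by [fan_acyclic] are the
   simple closed walks on at least three vertices: on one vertex there is the
   loop, and on two vertices the closed walk [:: x; y] uses a single edge
   twice and is not a cycle of a simple graph. *)
Record fan := Fan {
  fan_vertex :> finType;
  fan_edge : rel fan_vertex;
  fan_root : fan_vertex;
  fan_loops : reflexive fan_edge;
  fan_sym : symmetric fan_edge;
  fan_connected : forall x y : fan_vertex, connect fan_edge x y;
  fan_acyclic : forall c : seq fan_vertex,
    cycle fan_edge c -> uniq c -> size c <= 2;
  fan_degree : forall x : fan_vertex, x != fan_root ->
    #|[set y | (y != x) && fan_edge x y]| <= 2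
}.

Section FanOrder.
Variable A : fan.
Implicit Types (s t x y : A) (b C D : {set A}) (CC : {set {set A}}).

Definition fan_le s t : Prop :=
  exists p : seq A, [/\ path (@fan_edge A) t p, uniq (t :: p),
                        last t p = fan_root A & s \in t :: p].

Definition immediate_succ s t : Prop :=
  [/\ fan_le s t, s <> t &
      ~ exists p, [/\ p <> s, p <> t, fan_le s p & fan_le p t]].

Definition fan_rel s t : Prop := s = t \/ immediate_succ s t.

Definition linearly_ordered b : Prop :=
  forall x y, x \in b -> y \in b -> fan_le x y \/ fan_le y x.

Definition branch b : Prop :=
  linearly_ordered b /\
  forall b', linearly_ordered b' -> b \subset b' -> b' = b.

Definition height b : nat := #|b|.-1.

Definition chain CC : Prop :=
  (forall C, C \in CC -> C != set0) /\
  (forall C D, C \in CC -> D \in CC -> C \subset D \/ D \subset C).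

Definition down_closed C : Prop :=
  forall x y, fan_le x y -> y \in C -> x \in C.

Definition down_closed_chain CC : Prop :=
  chain CC /\ forall C, C \in CC -> down_closed C.

Definition down_closed_maximal_chain CC : Prop :=
  down_closed_chain CC /\
  forall D, D != set0 -> down_closed D -> down_closed_chain (D |: CC) ->
    D \in CC.

Definition canonical_chain CC : Prop :=
  exists bs : seq {set A},
    [/\ uniq bs, forall b, b \in bs <-> branch b &
        forall C, C \in CC -> forall i j, i < j -> j < size bs ->
          C :&: (nth set0 bs j :\ fan_root A) != set0 ->
          nth set0 bs i \subset C].

End FanOrder.

Record Fc := MkFc {
  Fc_fan :> fan;
  Fc_chain : {set {set Fc_fan}};
  Fc_chainP : down_closed_maximal_chain Fc_chain
}.

Record Fcc := MkFcc {
  Fcc_Fc :> Fc;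
  Fcc_canonical : canonical_chain (Fc_chain Fcc_Fc);
  Fcc_height : forall b b' : {set Fcc_Fc},
    branch b -> branch b' -> height b = height b'
}.

Definition fan_epimorphism (B A : fan) (f : B -> A) : Prop :=
  (forall x, exists y, f y = x) /\
  (forall x1 x2 : A, fan_rel x1 x2 <->
     exists y1 y2 : B, [/\ f y1 = x1, f y2 = x2 & fan_rel y1 y2]).

Definition epimorphism (B A : Fc) (f : B -> A) : Prop :=
  fan_epimorphism f /\
  forall C : {set B}, C \in Fc_chain B -> f @: C \in Fc_chain A.

(* The proof field is boolean so that two epimorphisms with the same underlying
   map are equal, making [epi B A] a finite type. *)
Record epi (B A : Fc) := Epi {
  epi_fun :> {ffun B -> A};
  epiP : `[< epimorphism epi_fun >]
}.
HB.instance Definition _ (B A : Fc) := [isSub for @epi_fun B A].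
HB.instance Definition _ (B A : Fc) := [Finite of epi B A by <:].

Lemma epimorphism_comp (C B A : Fc) (h : {ffun B -> A}) (g : {ffun C -> B}) :
  epimorphism h -> epimorphism g ->
  epimorphism [ffun x => h (g x)].
Proof.
move=> [[hs hR] hC] [[gs gR] gC]; split; first split.
- move=> x; have [y <-] := hs x; have [z <-] := gs y.
  by exists z; rewrite ffunE.
- move=> x1 x2; rewrite hR; split.
  + move=> [y1 [y2 [<- <- /gR [z1 [z2 [<- <- Rz]]]]]].
    by exists z1, z2; rewrite !ffunE.
  + move=> [z1 [z2 []]]; rewrite !ffunE => h1 h2 Rz.
    by exists (g z1), (g z2); split=> //; apply/gR; exists z1, z2.
- move=> D /gC/hC; rewrite -imset_comp.
  suff -> : [ffun x => h (g x)] @: D = (h \o g) @: D by [].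
  by apply: eq_imset => x; rewrite /= ffunE.
Qed.

Lemma epi_comp_subproof (C B A : Fc) (h : epi B A) (g : epi C B) :
  `[< epimorphism [ffun x => h (g x)] >].
Proof.
apply/asboolP; apply: epimorphism_comp.
- by move: (epiP h) => /asboolP.
- by move: (epiP g) => /asboolP.
Qed.

Definition epi_comp (C B A : Fc) (h : epi B A) (g : epi C B) : epi C A :=
  Epi (epi_comp_subproof h g).

(* Main.v *)
Require Import Defs.
From HB Require Import structures.
From mathcomp Require Import all_boot.
From mathcomp Require Import boolp zify.

Set Implicit Arguments.
Unset Strict Implicit.
Unset Printing Implicit Defensive.

(** Enumerate the vertices of a fan with chain in the order in which the chain
    collects them, the root being 0.  By maximality the members of the chain are
    exactly the nonempty initial segments ([chain_enum_exists]).  An epimorphism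
    sends initial segments to initial segments, that is, it is a rigid
    surjection between the two enumerations: new letters appear in increasing
    order ([epimorphism_rigid]).

    Let [U] be a comb: many branches, each of the same large height, with the
    branches collected one after the other.  A word [w] over the vertices of
    [A], one letter per branch, together with sets [X_i] of times, gives a map
    from [U] to [A]: branch [i] climbs from the root towards the vertex [w_i],
    one step at each time in [X_i], and stops there.  If [w] is rigid this is an
    epimorphism ([comb_map_epi]): a vertex of smaller index than [w_i] was the
    target of an earlier branch, so images of initial segments are initial
    segments.

    Now follow such a map [g] from [U] to [T], given by [u] and [Y_i], with an
    epimorphism [h] from [T] to [S].  Branch [i] climbs in [S] towards [h(u_i)],
    making a step only at those times of [Y_i] at which [h] does not collapse
    the edge.  So [h o g] is again of the same form, with word [h(u)] and with
    times [X_i] contained in [Y_i] ([thin_walk], [comb_map_comp]).  Two Ramsey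
    theorems finish the argument.  The finite Ramsey theorem, applied to the
    sets of times ([ramsey_subseq]), makes the colour of [h o g] a function of
    the word [h(u)] only; the dual Ramsey theorem of Graham and Rothschild
    ([graham_rothschild]) gives a rigid word [u] over [T] for which all the
    words [h(u)] have the same colour.

    The theorem of Graham and Rothschild is proved from that of Hales and
    Jewett, itself obtained by the method of Shelah; the finite Ramsey theorem
    is read off from it by looking at first occurrences of letters. *)

(** * Rigid words and substitution *)

Local Notation below a := (all (fun x => x < a)).

(** Parameter words: the letters below [a] are constants and the letters
    [a], [a.+1], ..., [b.-1] are parameters, which all occur and whose first
    occurrences come in this order.  The first argument of the recursion counts
    the letters met so far, so a word may be cut anywhere
    ([rigid_cat]).  For [a = 0] these are the rigid surjections onto
    [{0, ..., b - 1}], also known as restricted growth strings. *)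
Fixpoint rigid (a b : nat) (w : seq nat) : bool :=
  if w is x :: w' then (x <= a) && rigid (maxn a x.+1) b w' else a == b.

(** Substitution into a parameter word: the constants below [a] stay and the
    parameter [a + i] becomes the letter of rank [i] of [h]. *)
Definition fill1 (a : nat) (h : seq nat) (x : nat) : nat :=
  if x < a then x else nth 0 h (x - a).

Definition fill (a : nat) (h w : seq nat) : seq nat := map (fill1 a h) w.

Arguments fill : simpl never.

Lemma size_fill a h w : size (fill a h w) = size w.
Proof. exact: size_map. Qed.

Lemma fill_head a x h w : fill a (x :: h) (a :: w) = x :: fill a (x :: h) w.
Proof. by rewrite /fill /= {1}/fill1 ltnn subnn. Qed.

Lemma fill_cat a h u v : fill a h (u ++ v) = fill a h u ++ fill a h v.
Proof. exact: map_cat. Qed.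

Lemma rigid_cat a b c u v : rigid a b u -> rigid b c v -> rigid a c (u ++ v).
Proof.
elim: u a => [|x u IH] a /=; first by move/eqP->.
by case/andP=> -> /IH; apply.
Qed.

Lemma rigid_le a b w : rigid a b w -> a <= b.
Proof.
elim: w a => [|x w IH] a /=; first by move/eqP->.
by case/andP=> _ /IH; rewrite geq_max => /andP[].
Qed.

Lemma rigid_below a b w : rigid a b w -> below b w.
Proof.
elim: w a => [|x w IH] a //= /andP[_ H].
by rewrite (IH _ H) andbT; move: (rigid_le H); rewrite geq_max => /andP[].
Qed.

Lemma rigid_size a b w : rigid a b w -> b <= a + size w.
Proof.
elim: w a => [|x w IH] a /=; first by move/eqP->; rewrite addn0.
by case/andP=> zx /IH; lia.
Qed.

Lemma rigid_prefix a b p w : below a p -> rigid a b (p ++ w) = rigid a b w.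
Proof.
elim: p => [|x p IH] //= /andP[xa pa].
by rewrite (ltnW xa) (maxn_idPl xa) IH.
Qed.

Lemma rigid_letter a b w : rigid a b (a :: w) = rigid a.+1 b w.
Proof. by rewrite /= leqnn (maxn_idPr (leqnSn a)). Qed.

(** A parameter word is cut at the first occurrence of its first parameter,
    which is a constant from then on. *)
Lemma rigid_split a b w : rigid a b w -> a < b ->
  exists p t, [/\ w = p ++ a :: t, below a p & rigid a.+1 b t].
Proof.
elim: w => [|x w IH]; first by move=> /eqP-> ; rewrite ltnn.
move=> H ab; case: (ltngtP x a) => xa.
- have H' : rigid a b w by move: H; rewrite /= (maxn_idPl xa) => /andP[].
  have [p [t [-> pa tb]]] := IH H' ab.
  by exists (x :: p), t; split=> //=; rewrite xa.
- by move: H => /= /andP[]; rewrite leqNgt xa.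
- by subst x; exists [::], w; split=> //; rewrite -rigid_letter.
Qed.

Lemma rigid_const a w : rigid a a w = below a w.
Proof.
apply/idP/idP => [/rigid_below //|wa].
by rewrite -[w]cats0 rigid_prefix //= eqxx.
Qed.

Lemma rigid_line a w : rigid a a.+1 w = below a.+1 w && (a \in w).
Proof.
apply/idP/idP => [H|/andP[wa /path.splitPr H]].
  rewrite (rigid_below H) /=.
  have [p [t [-> _ _]]] := rigid_split H (ltnSn a).
  by rewrite mem_cat inE eqxx orbT.
have : exists p t, [/\ w = p ++ a :: t, below a p & below a.+1 t].
  case: H wa => p1 p2; elim: p1 => [|x p1 IH] /=.
    by case/andP=> _ H; exists [::], p2.
  case/andP; rewrite ltnS leq_eqVlt => /orP[/eqP->|xa].
    by exists [::], (p1 ++ a :: p2).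
  by case/IH=> p [t [-> pa ta]]; exists (x :: p), t; split=> //=; rewrite xa.
by case=> p [t [-> pa ta]]; rewrite rigid_prefix // rigid_letter rigid_const.
Qed.

Lemma rigid_iota a l : rigid a (a + l) (iota a l).
Proof.
elim: l a => [|l IH] a; first by rewrite addn0 /=.
by rewrite [iota _ _]/= rigid_letter addnS -addSn.
Qed.

(** Rigid words compose.  Allowing [h] to start with more constants than [u]
    is what lets a parameter be turned into a constant in [stabilise_tails]. *)
Lemma rigid_fill a s c h u :
  rigid a (a + size h) u -> a <= s -> rigid s c h -> rigid s c (fill a h u).
Proof.
(* Once the first i parameters of u have been met, the composite can show
   constants and the first i letters of h, all of which are below s. *)
have gen i : i <= size h -> rigid (a + i) (a + size h) u -> a <= s ->
    below s (take i h) -> rigid s c (drop i h) -> rigid s c (fill a h u).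
  elim: u i s => [|x u IH] i s ih /=.
    by rewrite eqn_add2l => /eqP-> _ _; rewrite drop_size.
  case/andP; rewrite leq_eqVlt => /orP[/eqP->|xai].
    rewrite (maxn_idPr (leqnSn _)) -addnS => Hu as_ Hb.
    have ih' : i < size h by move: (rigid_le Hu); rewrite leq_add2l.
    rewrite (drop_nth 0 ih') /= => /andP[xs Hh].
    rewrite /fill1 ltnNge leq_addr /= addKn xs /=.
    apply: (IH i.+1) => //; first by rewrite leq_max as_.
    rewrite (take_nth 0 ih') all_rcons leq_max ltnSn orbT /=.
    by apply: sub_all Hb => y ys; rewrite leq_max ys.
  rewrite (maxn_idPl xai) => Hu as_ Hb Hh.
  have Hx : fill1 a h x < s.
    rewrite /fill1; case: (ltnP x a) => xa; first exact: leq_trans xa as_.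
    have xi : x - a < i by lia.
    by rewrite -(nth_take 0 xi); apply: (allP Hb); apply: mem_nth; rewrite size_takel.
  by rewrite (ltnW Hx) (maxn_idPl Hx) /=; apply: (IH i).
by move=> Hu as_ Hh; apply: (gen 0) => //; rewrite ?addn0 ?take0 ?drop0.
Qed.

(** As 0 is a constant, the default value of [nth] is fixed by every
    substitution, so the law holds for arbitrary words. *)
Lemma fill_comp a h v u : 0 < a ->
  fill a h (fill a v u) = fill a (fill a h v) u.
Proof.
move=> a0; rewrite /fill -map_comp; apply: eq_map => x /=.
rewrite [fill1 a v x]/fill1 [RHS]/fill1; case: (ltnP x a) => xa.
  by rewrite /fill1 xa.
case: (ltnP (x - a) (size v)) => xv; first by rewrite (nth_map 0).
by rewrite !(nth_default 0) ?size_map // /fill1 a0.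
Qed.

Lemma fill_iota a p h :
  fill a (p ++ h) (iota (a + size p) (size h)) = h.
Proof.
apply: (@eq_from_nth _ 0); rewrite size_map size_iota // => i ih.
rewrite (nth_map 0) ?size_iota // nth_iota // /fill1 ifF; last by lia.
by rewrite nth_cat ifF; [congr (nth _ _ _); lia | lia].
Qed.

Lemma below_fill a b h w : below (a + size h) w -> a <= b -> below b h ->
  below b (fill a h w).
Proof.
move=> /allP wa ab /allP hb; apply/allP => _ /mapP[x /wa /= xa ->].
rewrite /fill1; case: (ltnP x a) => xa'; first exact: leq_trans ab.
by apply: hb; apply: mem_nth; rewrite ltn_subLR.
Qed.

(** Colouring [w] by the whole table of the values [e w y] for the finitely
    many short words [y]: one application of a Ramsey statement to this finite
    colouring serves all [y] at once. *)
Lemma vector_colouring b n (C : finType) : exists D : finType,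
  forall e : seq nat -> seq nat -> C, exists f : seq nat -> D,
  forall w w', f w = f w' ->
  forall y, below b y -> size y <= n -> e w y = e w' y.
Proof.
exists {ffun {bseq n of 'I_b} -> C} => e.
exists (fun w => [ffun y : {bseq n of 'I_b} => e w (map val y)]).
move=> w w' /ffunP H y yb yn.
have sz : size (pmap (insub : nat -> option 'I_b) y) <= n.
  by rewrite size_pmap; apply: leq_trans (count_size _ _) yn.
have := H (Bseq sz); rewrite !ffunE /=.
suff -> : map val (pmap (insub : nat -> option 'I_b) y) = y by [].
elim: y yb {yn sz H} => [|x y IH] //= /andP[xb yb].
by rewrite insubT /= IH.
Qed.

(** * The theorem of Hales and Jewett *)

(** Words with a single parameter are combinatorial lines.  The relation [E]
    says which points of the line must receive the same colour: all of them for
    Hales-Jewett, only those for two letters in the step of Shelah. *)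
Definition line_property (a : nat) (E : rel nat) : Prop :=
  forall C : finType, exists n, forall e : seq nat -> C,
  exists w, [/\ size w = n, rigid a a.+1 w &
    forall x y, x < a -> y < a -> E x y ->
      e (fill a [:: x] w) = e (fill a [:: y] w)].

(** A list [ws] of one-parameter words, each with its own parameter,
    concatenated and filled in with the letters of [p].  The truncation in [zip]
    gives the prefixes of the concatenation when [p] is shorter than [ws]. *)
Definition fill_blocks (a : nat) (ws : seq (seq nat)) (p : seq nat) : seq nat :=
  flatten [seq fill a [:: wx.2] wx.1 | wx <- zip ws p].

Lemma fill_blocks_cons a w ws x p :
  fill_blocks a (w :: ws) (x :: p) = fill a [:: x] w ++ fill_blocks a ws p.
Proof. by []. Qed.

Lemma size_fill_blocks a ws p : size p = size ws ->
  size (fill_blocks a ws p) = size (flatten ws).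
Proof.
elim: ws p => [|w ws IH] [|x p] //= [sz].
by rewrite fill_blocks_cons !size_cat size_fill IH.
Qed.

Lemma below_fill_blocks a b ws p : all (rigid a a.+1) ws -> a <= b -> below b p ->
  below b (fill_blocks a ws p).
Proof.
move=> Hws ab; elim: ws p Hws => [|w ws IH] [|x p] //= /andP[Hw Hws] /andP[xa pa].
rewrite fill_blocks_cons all_cat IH // andbT; apply: below_fill => //=.
  by rewrite addn1; apply: rigid_below Hw.
by rewrite xa.
Qed.

Lemma fill_blocks_rigid a s b ws h : all (rigid a a.+1) ws -> size h = size ws ->
  a <= s -> rigid s b h -> rigid s b (fill_blocks a ws h).
Proof.
elim: ws h s => [|w ws IH] [|x h] s //= /andP[Hw Hws] [sz] as_ /andP[xs Hh].
rewrite fill_blocks_cons; apply: rigid_cat (IH _ _ Hws sz _ Hh).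
  by apply: rigid_fill => //=; rewrite ?addn1 // xs /=.
by rewrite leq_max as_.
Qed.

Lemma fill_fill_blocks a h ws p : all (rigid a a.+1) ws ->
  fill a h (fill_blocks a ws p) = fill_blocks a ws (fill a h p).
Proof.
elim: ws p => [|w ws IH] [|x p] //= /andP[Hw Hws].
rewrite !fill_blocks_cons fill_cat IH //; congr (_ ++ _).
rewrite /fill -map_comp; apply/eq_in_map => z zw /=.
have : z < a.+1 by apply: (allP (rigid_below Hw)).
rewrite ltnS leq_eqVlt => /orP[/eqP->|za].
  by rewrite {2 3}/fill1 ltnn subnn.
by rewrite /fill1 za /= za.
Qed.

(** Lines are concatenated from left to right.  The first block is chosen for
    the vector of colours of all continuations of bounded length; this is why
    the conclusion holds with any suffix [y], and not only for full words. *)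
Lemma line_blocks a E : line_property a E -> forall l (C : finType), exists N,
  forall c : seq nat -> C, exists ws,
  [/\ size ws = l, all (rigid a a.+1) ws, size (flatten ws) = N &
      forall p p' y, size p <= l -> below a p -> below a p' -> all2 E p p' ->
        below a y -> size (fill_blocks a ws p) + size y <= N ->
        c (fill_blocks a ws p ++ y) = c (fill_blocks a ws p' ++ y)].
Proof.
move=> HE; elim=> [|l IH] C.
  exists 0 => c; exists [::]; split=> // p p' y.
  by case: p => // _ _; case: p'.
have [D HD] := vector_colouring a 1 C.
have [N' HN'] := IH D.
have [D2 HD2] := vector_colouring a N' C.
have [n Hn] := HE D2.
exists (n + N') => c.
have [f2 Hf2] := HD2 (fun w y => c (w ++ y)).
have [w [wn wr Hw]] := Hn f2.
have [f1 Hf1] := HD (fun z xs => c (fill a xs w ++ z)).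
have [ws [wsl wsr wsN Hws]] := HN' f1.
exists (w :: ws); split=> //=; first by rewrite wsl.
- by rewrite wr.
- by rewrite size_cat wn wsN.
move=> p p' y pl pa pa' Epp' ya.
case: p p' pl pa pa' Epp' => [|x p] [|x' p'] //=.
move=> pl /andP[xa pa] /andP[xa' pa'] /andP[Exx' Epp'].
rewrite !fill_blocks_cons -!catA size_cat size_fill wn -addnA leq_add2l => szy.
rewrite (Hf2 _ _ (Hw _ _ xa xa' Exx')).
- apply: (Hf1 _ _ _ [:: x']) => //=; last by rewrite xa'.
  exact: Hws.
- by rewrite all_cat ya below_fill_blocks.
- by rewrite size_cat.
Qed.

Lemma pigeonhole_eq (C : finType) (f : nat -> C) :
  exists i j, [/\ i < j, j <= #|C| & f i = f j].
Proof.
have : ~~ injectiveb (fun i : 'I_#|C|.+1 => f i).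
  by apply/negP=> /injectiveP/leq_card; rewrite card_ord ltnn.
case/injectivePn=> i [j ij fij].
wlog lij : i j ij fij / i < j.
  move=> H; have [lij|lji|/val_inj eij] := ltngtP i j; first exact: H fij lij.
    by apply: (H j i) => //; rewrite eq_sym.
  by rewrite eij eqxx in ij.
by exists i, j; split=> //; rewrite -ltnS.
Qed.

(** Among the words [a.+1 ... a.+1 a ... a] of length [#|C|] two have the same
    colour; the places where they differ carry the parameter of a line on which
    the letters [a] and [a.+1] cannot be told apart. *)
Lemma shelah_line a : line_property a.+2 (fun x y => minn x a == minn y a).
Proof.
move=> C; exists #|C| => e.
have [i [j [ij jC eij]]] :=
  pigeonhole_eq (fun i => e (nseq i a.+1 ++ nseq (#|C| - i) a)).
exists (nseq i a.+1 ++ nseq (j - i) a.+2 ++ nseq (#|C| - j) a); split.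
- by rewrite !size_cat !size_nseq; lia.
- rewrite rigid_line !all_cat !all_nseq !mem_cat !mem_nseq.
  by apply/andP; split; lia.
have fill_at x : fill a.+2 [:: x] (nseq i a.+1 ++ nseq (j - i) a.+2 ++
    nseq (#|C| - j) a) = nseq i a.+1 ++ nseq (j - i) x ++ nseq (#|C| - j) a.
  rewrite !fill_cat /fill !map_nseq /fill1 ltnSn ltnn subnn /=.
  by rewrite ifT //; lia.
have eqa : e (fill a.+2 [:: a] (nseq i a.+1 ++ nseq (j - i) a.+2 ++
    nseq (#|C| - j) a)) = e (fill a.+2 [:: a.+1] (nseq i a.+1 ++
    nseq (j - i) a.+2 ++ nseq (#|C| - j) a)).
  rewrite !fill_at; move: eij => /=.
  rewrite (_ : #|C| - i = (j - i) + (#|C| - j)); last by lia.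
  rewrite nseqD => ->; rewrite [in RHS]catA -nseqD.
  by congr (e (nseq _ _ ++ _)); lia.
move=> x y xa ya /eqP Exy.
have [->//|[[-> ->]|[-> ->]]] : x = y \/ ((x = a /\ y = a.+1) \/
  (x = a.+1 /\ y = a)) by lia.
- exact: eqa.
- by rewrite eqa.
Qed.

(** Induction on the alphabet: concatenated Shelah lines make the last two
    letters indistinguishable, so a line for the smaller alphabet, read along
    these blocks, works for the larger one as well. *)
Lemma hales_jewett a : line_property a.+1 (fun _ _ => true).
Proof.
elim: a => [|a IH] C.
  by exists 1 => e; exists [:: 1]; split=> // -[|x] [|y].
have [n Hn] := IH C.
have [N HN] := line_blocks (@shelah_line a) n C.
exists N => e.
have [ws [wsn wsr wsN Hws]] := HN e.
have [v [vn vr Hv]] := Hn (fun x => e (fill_blocks a.+2 ws x)).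
move: (vr); rewrite rigid_line => /andP[vb va].
pose v' := fill a.+1 [:: a.+2] v.
have szv' : size v' = size ws by rewrite size_fill vn wsn.
have fillv' x : fill a.+2 [:: x] v' = fill a.+1 [:: x] v.
  rewrite /fill -map_comp; apply/eq_in_map => z /(allP vb) /=.
  rewrite ltnS leq_eqVlt => /orP[/eqP->|za].
    by rewrite /fill1 ltnn subnn /= ltnn subnn.
  by rewrite /fill1 za /= ifT // ltnW.
exists (fill_blocks a.+2 ws v'); split.
- by rewrite size_fill_blocks.
- apply: fill_blocks_rigid => //; rewrite rigid_line; apply/andP; split.
    by apply: below_fill; rewrite /= ?addn1 ?leqnn // ltnW.
  by rewrite /v' /fill; apply/mapP; exists a.+1; rewrite // /fill1 ltnn subnn.
move=> x y xa ya _; rewrite !fill_fill_blocks // !fillv'.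
(* The last letter a.+1 may be replaced by a, as minn z a does. *)
have merge z : z < a.+2 -> e (fill_blocks a.+2 ws (fill a.+1 [:: z] v)) =
    e (fill_blocks a.+2 ws (fill a.+1 [:: minn z a] v)).
  move=> za; rewrite -[fill_blocks _ _ _]cats0 -[in RHS](cats0 (fill_blocks _ _ _)).
  have bel z' : z' < a.+2 -> below a.+2 (fill a.+1 [:: z'] v).
    by move=> za'; apply: below_fill; rewrite /= ?addn1 ?za'.
  apply: Hws => //; rewrite ?size_fill ?vn //; try by apply: bel; lia.
    rewrite /fill all2E !size_map eqxx /= zip_map all_map.
    apply/allP => t _ /=; rewrite /fill1; case: ifP => _; first exact: eqxx.
    by case: (t - a.+1) => [|[]] /=; rewrite ?eqxx //; lia.
  by rewrite addn0 size_fill_blocks ?wsN ?leqnn // size_fill vn wsn.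
rewrite (merge _ xa) (merge _ ya); apply: Hv => //; lia.
Qed.

(** * The theorem of Graham and Rothschild *)

Definition parameter_ramsey (a k : nat) : Prop :=
  forall l (C : finType), exists N, forall e : seq nat -> C,
  exists u, [/\ size u = N, rigid a (a + l) u &
    forall h h', size h = l -> size h' = l ->
      rigid a (a + k) h -> rigid a (a + k) h' -> e (fill a h u) = e (fill a h' u)].

(** Without parameters in [h], this is the multidimensional theorem of Hales
    and Jewett. *)
Lemma parameter_ramsey0 a : parameter_ramsey a.+1 0.
Proof.
move=> l C; have [N HN] := line_blocks (@hales_jewett a) l C.
exists N => e; have [ws [wsl wsr wsN Hws]] := HN e.
exists (fill_blocks a.+1 ws (iota a.+1 l)); split.
- by rewrite size_fill_blocks ?size_iota.
- by apply: fill_blocks_rigid; rewrite ?size_iota // rigid_iota.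
move=> h h' hl hl'; rewrite addn0 !rigid_const => ha ha'.
have fi g : size g = l -> fill a.+1 g (iota a.+1 l) = g.
  by move=> <-; have := fill_iota a.+1 [::] g; rewrite addn0.
rewrite !fill_fill_blocks // !fi //.
rewrite -[fill_blocks _ _ _]cats0 -[in RHS](cats0 (fill_blocks _ _ _)).
apply: Hws; rewrite ?hl ?addn0 //; last by rewrite size_fill_blocks ?wsN // wsl.
by rewrite all2E hl hl' eqxx /=; apply/allP.
Qed.

(** Cut a word with [k.+1] parameters at the first occurrence of its first
    parameter, as [p ++ a.+1 :: t].  The tail [t] has only [k] parameters, over
    an alphabet with one more constant, so the Ramsey property for [k] can make
    the colour independent of [t].  The possible lengths of [p] are treated in
    turn: the case of empty [p] by the Ramsey property itself, and the others by
    recursion after removing the first letter of [p], for the vector of colours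
    indexed by this letter. *)
Lemma stabilise_tails a k : parameter_ramsey a.+2 k ->
  forall l (C : finType), exists N, forall e : seq nat -> C,
  exists u, [/\ size u = N, rigid a.+1 (a.+1 + l) u &
    forall p t t', below a.+1 p -> size p + (size t).+1 = l ->
      size t = size t' -> rigid a.+2 (a.+2 + k) t -> rigid a.+2 (a.+2 + k) t' ->
      e (fill a.+1 (p ++ a.+1 :: t) u) = e (fill a.+1 (p ++ a.+1 :: t') u)].
Proof.
move=> GR; set b := a.+1; elim=> [|l IH] C.
  exists 0 => e; exists [::]; split=> //; first by rewrite addn0 /=.
have [D HD] := vector_colouring b 1 C.
have [M HM] := IH D.
have [n Hn] := GR M C.
exists n.+1 => e.
have [w [wn wr Hw]] := Hn (fun z => e (b :: z)).
have [f Hf] := HD (fun y xs => e (xs ++ fill b (xs ++ y) w)).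
have [v [vM vr Hv]] := HM f.
(* Filling with iota b.+1 l shifts the parameters of v by one, to make room
   for the new first parameter b. *)
pose v1 := b :: fill b (iota b.+1 l) v.
have v1r : rigid b (b + l.+1) v1.
  rewrite /v1 rigid_letter -addSnnS; apply: rigid_fill; rewrite ?size_iota //.
  exact: rigid_iota.
have fillv1 x h : size h = l -> fill b (x :: h) v1 = x :: fill b h v.
  move=> hl; rewrite /v1 fill_head fill_comp //; congr (_ :: _).
  congr (fill b _ v); have := fill_iota b [:: x] h.
  by rewrite hl addn1.
exists (fill b v1 (b :: w)); split.
- by rewrite size_fill /= wn.
- apply: rigid_fill => //; rewrite /= size_fill vM.
  by rewrite leqnn (maxn_idPr (leqnSn b)) addnS -addSn.
move=> [|x p] t t' /= pa.
  rewrite add0n => -[tl] tt' tr tr'.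
  rewrite !fill_comp // !fillv1 -?tt' // !fill_head.
  have fw y : fill b (b :: y) w = fill b.+1 y w.
    apply: eq_map => z; rewrite /fill1 (ltnS z b) (leq_eqVlt z b).
    case: (ltngtP z b) => zb //=; last by rewrite zb subnn.
    by rewrite -[z - b]prednK ?subn_gt0 // -subnS.
  rewrite !fw; apply: Hw; rewrite ?size_fill //.
    by apply: rigid_fill => //; rewrite tl.
  by apply: rigid_fill => //; rewrite -tt' tl.
case/andP: pa => xa pa; rewrite addSn => -[szl] tt' tr tr'.
have hl s : size s = size t -> size (p ++ b :: s) = l.
  by move=> st; rewrite size_cat /= st.
rewrite !fill_comp // !fillv1 ?hl // !fill_head.
apply: (Hf _ _ _ [:: x]); rewrite /= ?xa //; exact: Hv.
Qed.

(** Filling a parameter word with a marking discards all of its parameters but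
    those in [Z]; the discarded ones become the constant 0. *)
Definition marking (a : nat) (Z s : seq nat) : seq nat :=
  [seq if x \in Z then a + index x Z else 0 | x <- s].

Lemma rigid_marking a Z s : 0 < a -> uniq s -> subseq Z s ->
  rigid a (a + size Z) (marking a Z s).
Proof.
elim: s a Z => [|x s IH] a [|z Z] a0 //=; rewrite ?addn0 ?eqxx //.
  move=> /andP[_ us] _; rewrite (maxn_idPl a0).
  by have := IH a [::] a0 us (sub0seq _); rewrite addn0.
case/andP=> xs us; case: eqP => [->|/eqP zx] ZS.
  rewrite in_cons eqxx /= addn0 leqnn (maxn_idPr (leqnSn a)) addnS -addSn /=.
  move: (IH a.+1 Z (ltn0Sn a) us ZS); congr (rigid _ _ _).
  apply/eq_in_map => y ys /=; rewrite in_cons.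
  have yx : y != x by apply: contraNneq xs => <-.
  by rewrite (negPf yx) /= eq_sym (negPf yx) addSnnS.
have /negPf -> : x \notin z :: Z.
  by apply: contra xs; apply: (mem_subseq ZS).
by rewrite /= (maxn_idPl a0); exact: IH.
Qed.

Lemma pigeonhole_count (C : finType) l (f : nat -> C) (c0 : C) :
  exists c, l <= count (fun i => f i == c) (iota 0 (#|C| * l)).
Proof.
have [->|l0] := posnP l; first by exists c0.
apply: contrapT => nex.
have H c : count (fun i => f i == c) (iota 0 (#|C| * l)) < l.
  by rewrite ltnNge; apply/negP => H; apply: nex; exists c.
have : \sum_c count (fun i => f i == c) (iota 0 (#|C| * l)) = #|C| * l.
  rewrite -{2}(size_iota 0 (#|C| * l)); elim: (iota _ _) => [|x s IH] /=.
    by rewrite big1.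
  rewrite big_split /= IH (bigD1 (f x)) //= eqxx big1 ?addn0 ?add1n // => c.
  by rewrite eq_sym => /negPf->.
have : \sum_c count (fun i => f i == c) (iota 0 (#|C| * l)) <= #|C| * l.-1.
  rewrite (_ : #|C| * l.-1 = \sum_(c : C) l.-1); last by rewrite sum_nat_const.
  apply: leq_sum => c _.
  by have := H c; lia.
have : 0 < #|C| by apply/card_gt0P; exists c0.
nia.
Qed.

Lemma fill_blocks_split a ws p x t : size p < size ws ->
  fill_blocks a ws (p ++ x :: t) =
  fill_blocks a ws p ++ fill a [:: x] (nth [::] ws (size p)) ++
  fill_blocks a (drop (size p).+1 ws) t.
Proof.
elim: p ws => [|y p IH] [|w ws] //= pw; first by rewrite fill_blocks_cons drop0.
by rewrite !fill_blocks_cons IH // catA.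
Qed.

(** First the colour is made independent of the tail, then, by concatenated
    lines, independent of the letters of the prefix.  It remains a function
    [D] of the number of the block in which the first parameter occurs;
    by the pigeonhole principle it is constant on enough blocks, and the other
    blocks are filled with the constant 0. *)
Lemma parameter_ramseyS a k :
  parameter_ramsey a.+2 k -> parameter_ramsey a.+1 k.+1.
Proof.
move=> GR l C; set b := a.+1.
have [N1 HN1] := line_blocks (@hales_jewett a) (#|C| * l) C.
have [N0 HN0] := stabilise_tails GR N1 C.
exists N0 => e.
have [u0 [u0N u0r Hu0]] := HN0 e.
(* A tail of the right length for the prefix P, used as a representative:
   the colour after P does not depend on it. *)
pose std (P : seq nat) := iota b.+1 k ++ nseq (N1 - size P - 1 - k) 0.
pose c P := e (fill b (P ++ b :: std P) u0).
have [ws [wsl wsr wsN Hws]] := HN1 c.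
(* The constants in front of the parameter of block i also precede the first
   occurrence of b; they are the suffix y of line_blocks. *)
pose pre i := take (index b (nth [::] ws i)) (nth [::] ws i).
pose D i := c (fill_blocks b ws (nseq i 0) ++ pre i).
have [d Hd] := pigeonhole_count l D (e [::]).
pose s := iota 0 (#|C| * l).
pose Z := take l [seq i <- s | D i == d].
have Zl : size Z = l by rewrite size_takel // size_filter.
have Zs : subseq Z s.
  by apply: subseq_trans (filter_subseq _ s); exact: take_subseq.
pose v := marking b Z s.
have vs : size v = size ws by rewrite size_map size_iota wsl.
have vr : rigid b (b + l) v.
  by rewrite -Zl; apply: rigid_marking => //; exact: iota_uniq.
exists (fill b (fill_blocks b ws v) u0); split.
- by rewrite size_fill.
- apply: rigid_fill; rewrite ?size_fill_blocks ?wsN //.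
  by apply: fill_blocks_rigid.
suff main h : size h = l -> rigid b (b + k.+1) h ->
    e (fill b h (fill b (fill_blocks b ws v) u0)) = d.
  by move=> h h' hl hl' hr hr'; rewrite !main.
move=> hl hr; rewrite fill_comp // fill_fill_blocks //.
have h2r : rigid b (b + k.+1) (fill b h v) by apply: rigid_fill; rewrite ?hl.
have h2s : size (fill b h v) = size ws by rewrite size_fill.
have [p [t [Eh2 pb tr]]] : exists p t,
    [/\ fill b h v = p ++ b :: t, below b p & rigid b.+1 (b + k.+1) t].
  by apply: rigid_split => //; rewrite addnS ltnS leq_addr.
have pws : size p < size ws by rewrite -h2s Eh2 size_cat /= addnS ltnS leq_addr.
have Jp : D (size p) == d.
  have : nth 0 (fill b h v) (size p) = b by rewrite Eh2 nth_cat ltnn subnn.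
  rewrite (nth_map 0) ?vs // (nth_map 0) ?size_iota -?wsl //.
  rewrite nth_iota -?wsl // add0n; case: ifP => [|_].
    by move/mem_take; rewrite mem_filter => /andP[].
  by rewrite /fill1 /b.
have h3r : rigid b (b + k.+1) (fill_blocks b ws (fill b h v)).
  exact: fill_blocks_rigid.
have h3s : size (fill_blocks b ws (fill b h v)) = N1 by rewrite size_fill_blocks ?wsN.
have [wr wb] : below b.+1 (nth [::] ws (size p)) /\ b \in nth [::] ws (size p).
  by apply/andP; rewrite -rigid_line; apply: (allP wsr); apply: mem_nth.
have preb : below b (pre (size p)).
  apply/allP => z zp; have := allP wr z (mem_take zp).
  rewrite /= ltnS leq_eqVlt => /orP[/eqP zb|//].
  by move: zp; rewrite zb /pre in_take // ltnn.
set P := fill_blocks b ws p ++ pre (size p).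
have Pb : below b P by rewrite all_cat preb below_fill_blocks.
have [t3 Et3] : exists t3, fill_blocks b ws (fill b h v) = P ++ b :: t3.
  rewrite Eh2 fill_blocks_split //.
  have -> : fill b [:: b] (nth [::] ws (size p)) = nth [::] ws (size p).
    rewrite /fill; apply: map_id_in => z /(allP wr) /=.
    rewrite /fill1 (ltnS z b) (leq_eqVlt z b); case: ltngtP => //= zb.
    by rewrite zb subnn.
  rewrite -[X in _ ++ X ++ _](cat_take_drop (index b (nth [::] ws (size p)))).
  rewrite (drop_nth 0) ?index_mem // nth_index //.
  by eexists; rewrite /P /pre -!catA /=.
have t3r : rigid b.+1 (b + k.+1) t3.
  by move: h3r; rewrite Et3 rigid_prefix // rigid_letter.
have szP : size P + (size t3).+1 = N1 by rewrite -h3s Et3 size_cat.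
have t3k : k <= size t3.
  by have := rigid_size t3r; rewrite addSnnS leq_add2l ltnS.
rewrite Et3 (_ : e _ = c P); last first.
  apply: Hu0 => //.
  - rewrite /std size_cat size_iota size_nseq; move: (size P) (size t3) szP t3k.
    by clear=> i j; lia.
  - by rewrite addSnnS.
  - rewrite /std /=; apply: (rigid_cat (rigid_iota _ _)).
    by rewrite rigid_const all_nseq orbT.
rewrite -(eqP Jp).
apply: Hws; rewrite ?size_cat //.
- by rewrite -wsl ltnW.
- by rewrite all_nseq orbT.
- by rewrite all2E size_nseq eqxx /=; apply/allP.
- by rewrite -[X in X <= _]size_cat -/P -szP leq_addr.
Qed.

Theorem graham_rothschild a k : parameter_ramsey a.+1 k.
Proof.
elim: k a => [|k IH] a; first exact: parameter_ramsey0.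
exact: parameter_ramseyS.
Qed.

Lemma rigid_mem a b w j : rigid a b w -> a <= j < b -> j \in w.
Proof.
elim: w a => [|x w IH] a /=; first by move/eqP->; lia.
case/andP=> xa /IH H /andP[aj jb]; rewrite in_cons; case: eqP => //= jx.
by apply: H; rewrite jb andbT geq_max aj /=; lia.
Qed.

(** In a rigid word every letter is preceded by all the smaller
    parameters; [rigid_of_prev] is the converse for words without constants. *)
Lemma rigid_prev a b w n i : rigid a b w -> n < size w -> a <= i ->
  i < nth 0 w n -> i \in take n w.
Proof.
elim: w a n => [|x w IH] a [|n] //= /andP[xa Hw] nw ai iw.
  by move: (leq_trans iw (leq_trans xa ai)); rewrite ltnn.
rewrite in_cons; case: eqP => //= ix; apply: (IH _ n Hw) => //.
by rewrite geq_max ai /=; lia.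
Qed.

Lemma rigid_of_prev b w : below b w -> (forall j, j < b -> j \in w) ->
  (forall n i, n < size w -> i < nth 0 w n -> i \in take n w) -> rigid 0 b w.
Proof.
move=> wb wm wp.
suff H n : n <= size w -> exists2 s, rigid 0 s (take n w) &
    forall i, (i < s) = (i \in take n w).
  have [s] := H _ (leqnn _); rewrite take_size => sr si.
  suff <- : s = b by [].
  apply/eqP; rewrite eqn_leq; apply/andP; split.
    case: s sr si => // s sr si; have := si s.
    by rewrite ltnSn => /esym/(allP wb).
  by rewrite leqNgt; apply/negP => /wm; rewrite -si ltnn.
elim: n => [|n IH] nw; first by rewrite take0; exists 0.
have [s sr si] := IH (ltnW nw).
have xs : nth 0 w n <= s.
  by rewrite leqNgt; apply/negP => /(wp _ _ nw); rewrite -si ltnn.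
exists (maxn s (nth 0 w n).+1).
  by rewrite (take_nth 0 nw) -cats1; apply: rigid_cat sr _; rewrite /= xs eqxx.
move=> i; rewrite (take_nth 0 nw) mem_rcons in_cons -si.
by lia.
Qed.

(** The finite Ramsey theorem.  A [K]-subset is coded by a word in
    which the elements are the first occurrences of the [K] parameters; the
    first occurrences in a homogeneous [u] form the homogeneous set [Y], since a
    [K]-subset of [Y] is obtained by filling [u] with a marking word. *)
Lemma ramsey_subseq K M (C : finType) : exists m, forall F : seq nat -> C,
  exists Y, [/\ size Y = M, sorted ltn Y, below m Y &
    forall X X', subseq X Y -> subseq X' Y -> size X = K -> size X' = K ->
      F X = F X'].
Proof.
have [m Hm] := @graham_rothschild 0 K M C; exists m => F.
have [u [um ur Hu]] := Hm (fun w => F [seq index j w | j <- iota 1 K]).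
pose pos := fun j => index j u.
have posm j : j \in iota 1 M -> j \in u.
  by rewrite mem_iota => /(rigid_mem ur).
exists (map pos (iota 1 M)); split.
- by rewrite size_map size_iota.
- apply/(sortedP 0) => i; rewrite size_map size_iota => iM.
  rewrite !(nth_map 0) ?size_iota ?(ltnW iM) // !nth_iota ?(ltnW iM) //.
  have im : 1 + i.+1 \in u by apply: posm; rewrite mem_iota; lia.
  have := @rigid_prev _ _ _ (index (1 + i.+1) u) (1 + i) ur.
  rewrite index_mem nth_index // => /(_ im isT (ltnSn _)).
  by rewrite in_take //; apply: posm; rewrite mem_iota; lia.
- by apply/allP => _ /mapP[j /posm ju ->]; rewrite -um index_mem.
suff main X : subseq X (map pos (iota 1 M)) -> size X = K ->
    exists h, [/\ size h = M, rigid 1 (1 + K) h &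
      X = [seq index j (fill 1 h u) | j <- iota 1 K]].
  move=> X X' sX sX' zX zX'.
  have [h [hM hr ->]] := main _ sX zX; have [h' [hM' hr' ->]] := main _ sX' zX'.
  exact: Hu.
move=> /subseqP[bs]; rewrite size_map size_iota -map_mask => sbs ->.
set Z := mask bs _ => zX; rewrite size_map in zX.
have ZM : subseq Z (iota 1 M) by apply: mask_subseq.
have uZ : uniq Z by apply: subseq_uniq ZM (iota_uniq _ _).
exists (marking 1 Z (iota 1 M)); split.
- by rewrite size_map size_iota.
- by rewrite -zX; apply: rigid_marking ZM => //; exact: iota_uniq.
apply: (@eq_from_nth _ 0); rewrite !size_map ?size_iota // => i.
rewrite zX => iK; rewrite !(nth_map 0) ?size_iota ?zX // nth_iota //.
rewrite /pos /index /fill find_map; apply: eq_in_find => x xu /=.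
have := allP (rigid_below ur) x xu => /= xM.
rewrite /fill1; case: (posnP x) => [->|x0].
  have : nth 0 Z i \in iota 1 M by apply: (mem_subseq ZM); rewrite mem_nth ?zX.
  by rewrite mem_iota /= eq_sym => /andP[]; case: (nth 0 Z i).
rewrite ltnNge x0 /= (nth_map 0) ?size_iota; last by lia.
rewrite nth_iota ?subnKC //; last by lia.
case: ifP => xZ.
  apply/eqP/eqP => [E|]; last by rewrite !add1n => -[E]; rewrite -E nth_index.
  by rewrite E index_uniq ?zX.
by apply/negbTE; apply: contraFneq xZ => ->; rewrite mem_nth ?zX.
Qed.

(** * Fans as trees with a parent map *)

Section FanTree.
Variable A : fan.
Local Notation e := (@fan_edge A).
Local Notation root := (@fan_root A).
Implicit Types (par : A -> A) (ht : A -> nat).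

(** If two simple paths leave [x] by different vertices, follow the second up to
    its first return to the first path and come back along the latter: this is a
    simple cycle on at least three vertices. *)
Lemma path_last_unique (x : A) p q :
  path e x p -> uniq (x :: p) -> path e x q -> uniq (x :: q) ->
  last x p = last x q -> p = q.
Proof.
elim: p x q => [|y p IH] x [|z q] //.
- by move=> _ _ _ /andP[xq _] /= xl; case/negP: xq; rewrite {1}xl mem_last.
- by move=> _ /andP[xq _] _ _ /= xl; case/negP: xq; rewrite -{1}xl mem_last.
have [<-|yz] := eqVneq y z.
  move=> /andP[_ py] /andP[_ uy] /andP[_ qy] /andP[_ uy'] /= lpq.
  by congr (_ :: _); apply: IH lpq.
move=> pp up pq uq lpq; exfalso.
have hq : has (mem (y :: p)) (z :: q).
  apply/hasP; exists (last z q); first exact: mem_last.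
  by move: lpq => /= <-; exact: mem_last.
have [w [q1 [q2 [Eq wp q1p]]]] : exists w q1 q2,
    [/\ z :: q = rcons q1 w ++ q2, w \in y :: p & ~~ has (mem (y :: p)) q1].
  by case: (split_find hq) => w q1 q2 wp q1p; exists w, q1, q2.
have [p1 [p2 Ep]] : exists p1 p2, y :: p = rcons p1 w ++ p2.
  by case: (path.splitP wp) => p1 p2; exists p1, p2.
have [pp1 up1] : path e x (rcons p1 w) /\ uniq (x :: rcons p1 w).
  move: pp up; rewrite Ep cat_path -cat_cons cat_uniq.
  by case/andP=> -> _ /andP[-> _].
have [pq1 uq1] : path e x (rcons q1 w) /\ uniq (x :: rcons q1 w).
  move: pq uq; rewrite Eq cat_path -cat_cons cat_uniq.
  by case/andP=> -> _ /andP[-> _].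
have back : path e w (rcons (rev p1) x).
  have := rev_path e x (rcons p1 w); rewrite last_rcons belast_rcons rev_cons => ->.
  rewrite (_ : path _ x _ = path e x (rcons p1 w)) //.
  by apply: eq_path => s t; rewrite fan_sym.
have := @fan_acyclic A (x :: rcons q1 w ++ rev p1).
rewrite /= rcons_cat cat_path pq1 last_rcons back => /(_ isT).
rewrite mem_cat mem_rev cat_uniq rev_uniq.
move: up1 uq1; rewrite /= !mem_rcons !rcons_uniq !in_cons !negb_or.
move=> /andP[/andP[xw xp1] /andP[wp1 ->]] /andP[/andP[-> xq1] uq1].
rewrite (negPf xp1) (negPf xq1) uq1 andbT /=.
have -> : has (mem (rcons q1 w)) (rev p1) = false.
  apply/hasP => -[s]; rewrite mem_rev /= => sp1.
  rewrite mem_rcons in_cons => /orP[/eqP sw|sq1].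
    by rewrite -sw sp1 in wp1.
  case/hasP: q1p; exists s => //=; rewrite Ep mem_cat mem_rcons in_cons sp1.
  by rewrite orbT.
move=> /(_ isT); rewrite size_cat size_rcons size_rev.
rewrite addSn !ltnS leqn0 addn_eq0 => /andP[/nilP q10 /nilP p10].
by move: Eq Ep; rewrite q10 p10 => -[zw _] [yw _]; rewrite zw yw eqxx in yz.
Qed.

Definition parent_map par ht : Prop :=
  [/\ par root = root, ht root = 0 &
      forall t, t != root -> e t (par t) /\ ht t = (ht (par t)).+1].

Lemma parent_map_exists : exists par ht, parent_map par ht.
Proof.
have simple t : exists p, [/\ path e t p, uniq (t :: p) & last t p = root].
  have /connectP[p tp ->] := fan_connected t root.
  by case/shortenP: tp => q tq uq _; exists q.
have [rp Hrp] := choice simple.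
exists (fun t => head root (rp t)), (fun t => size (rp t)); split.
- by have [_ /=] := Hrp root; case: (rp root) => //= y p /andP[/negP + _] E;
    rewrite -{1}E mem_last.
- by have [_ /=] := Hrp root; case: (rp root) => //= y p /andP[/negP + _] E;
    rewrite -{1}E mem_last.
move=> t troot; have [] := Hrp t; case Et : (rp t) => [|y p] /=.
  by move=> _ _ E; rewrite E eqxx in troot.
case/andP=> ty yp /andP[_ up] lp; split=> //; congr (_.+1).
have [yp' up' lp'] := Hrp y.
by rewrite (path_last_unique yp up yp' up') // lp'.
Qed.

Section ParentMap.
Variables (par : A -> A) (ht : A -> nat).
Hypothesis parP : parent_map par ht.

Lemma par_root : par root = root. Proof. by case: parP. Qed.

Lemma ht_root : ht root = 0. Proof. by case: parP. Qed.

Lemma ht_par t : ht (par t) = (ht t).-1.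
Proof.
have [pr hr H] := parP; have [->|/H[_ ->] //] := eqVneq t root.
by rewrite pr hr.
Qed.

Lemma ht_eq0 t : ht t = 0 -> t = root.
Proof. by case: parP => _ _ H; have [//|/H[_ ->]] := eqVneq t root. Qed.

Lemma ht_iter i t : ht (iter i par t) = ht t - i.
Proof. by elim: i => [|i IH]; rewrite ?subn0 //= ht_par IH subnS. Qed.

Lemma iter_root i : iter i par root = root.
Proof. by elim: i => //= i ->; exact: par_root. Qed.

Lemma iter_ht i t : ht t <= i -> iter i par t = root.
Proof. by move=> ti; apply: ht_eq0; rewrite ht_iter; apply/eqP. Qed.

(** The iterates of the parent map run along a simple path to the root, which is
    the only one. *)
Lemma fan_leP s t : fan_le s t <-> exists i, s = iter i par t.
Proof.
have trajectory n x : ht x = n ->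
    [/\ path e x (traject par (par x) n), uniq (x :: traject par (par x) n) &
        last x (traject par (par x) n) = root].
  elim: n x => [|n IH] x xn; first by rewrite /= (ht_eq0 xn).
  have xr : x != root by apply: contra_eqN xn => /eqP->; rewrite ht_root.
  have [_ _ /(_ _ xr)[ex _]] := parP.
  have [] := IH (par x); first by rewrite ht_par xn.
  rewrite /= ex => -> /andP[-> ->] ->; split=> //; rewrite !andbT.
  apply/negP; rewrite -[_ :: _]/(traject par (par x) n.+1). move=> /trajectP[i _].
  by move/(congr1 ht); rewrite ht_iter ht_par xn; lia.
have [tp tu tl] := trajectory _ t erefl.
split=> [[p [pp up lp sp]]|[i ->]].
  have Ep := path_last_unique tp tu pp up; rewrite tl lp in Ep.
  move: sp; rewrite -Ep // -[_ :: _]/(traject par t (ht t).+1).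
  by move=> /trajectP[i _ ->]; exists i.
exists (traject par (par t) (ht t)); split=> //.
rewrite -[_ :: _]/(traject par t (ht t).+1); apply/trajectP.
case: (leqP i (ht t)) => it; first by exists i.
by exists (ht t) => //; rewrite !iter_ht // ltnW.
Qed.

Lemma fan_le_ht_eq s t : fan_le s t -> ht t <= ht s -> s = t.
Proof.
case/fan_leP => -[//|i ->]; rewrite ht_iter => H.
have t0 : ht t = 0 by lia.
by rewrite (ht_eq0 t0) iter_root.
Qed.

Lemma fan_le_root t : fan_le root t.
Proof. by apply/fan_leP; exists (ht t); rewrite iter_ht. Qed.

(** Along the parent map heights drop by one, so nothing lies strictly between a
    vertex and its parent. *)
Lemma fan_relP s t : fan_rel s t <-> s = t \/ s = par t.
Proof.
split=> [[->|[st neq nbetween]]|]; [by left| |].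
  right; have /fan_leP[[//|i Es]] := st.
  have [pt|/eqP pt] := eqVneq (par t) t.
    by case: neq; rewrite Es; elim: (i.+1) => //= j ->.
  have [ps|/eqP ps] := eqVneq (par t) s; first by [].
  case: nbetween; exists (par t); split=> //; apply/fan_leP.
    by exists i; rewrite Es iterSr.
  by exists 1.
case=> Es; first by left.
have [|/eqP neq] := eqVneq s t; first by left.
right; split=> //; first by apply/fan_leP; exists 1.
move=> [p [/eqP ps /eqP pt sp /fan_leP[[|j] Ep]]]; first by rewrite Ep eqxx in pt.
case/eqP: ps; apply: esym; apply: fan_le_ht_eq => //.
by rewrite Ep Es ht_iter ht_par; lia.
Qed.

(** The vertex at height [c] on the path from the root to [v], or [v] itself
    when [c] exceeds its height. *)
Definition anc (v : A) (c : nat) : A := iter (ht v - c) par v.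

Lemma anc_id v c : ht v <= c -> anc v c = v.
Proof. by move=> vc; rewrite /anc (eqP vc). Qed.

Lemma anc0 v : anc v 0 = root.
Proof. by rewrite /anc subn0 iter_ht. Qed.

Lemma anc_step v c : anc v c = anc v c.+1 \/ anc v c = par (anc v c.+1).
Proof.
case: (leqP (ht v) c) => vc; first by left; rewrite !anc_id // leqW.
by right; rewrite /anc -iterS -subSn.
Qed.

(** Each ancestor is recovered from its height. *)
Lemma anc_ht_iter v i : anc v (ht (iter i par v)) = iter i par v.
Proof.
rewrite /anc ht_iter; case: (leqP i (ht v)) => iv; first by rewrite subKn.
by rewrite !iter_ht // ?(ltnW iv) // (eqP (ltnW iv)) subn0.
Qed.

Lemma fan_le_anc v c : fan_le (anc v c) v.
Proof. by apply/fan_leP; eexists. Qed.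

End ParentMap.

End FanTree.

(** * Chains as enumerations of the vertices *)

(** A maximal downwards closed chain is the same as a listing of the vertices
    compatible with the tree order, its members being the nonempty initial
    segments of the listing. *)
Definition chain_enum (A : Fc) (vs : seq A) : Prop :=
  [/\ uniq vs, forall x, x \in vs,
      forall x y : A, fan_le x y -> index x vs <= index y vs &
      forall P : {set A}, P \in Fc_chain A <->
        P != set0 /\
        forall x y, y \in P -> index x vs <= index y vs -> x \in P].

(** Sort the vertices by the number of members of the chain that avoid them and
    break ties by height.  Then members of the chain are initial segments.
    Conversely an initial segment is downwards closed, as an ancestor comes
    earlier, and comparable with every member, so maximality of the chain makes
    it a member. *)
Lemma chain_enum_exists (A : Fc) : exists vs, @chain_enum A vs.
Proof.
have [par [ht parP]] := parent_map_exists A.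
have [[[chain0 chainI] chainD] chainM] := Fc_chainP A.
pose K (x : A) := #|[set C in Fc_chain A | x \notin C]|.
pose le (x y : A) := (K x < K y) || (K x == K y) && (ht x <= ht y).
have le_tot : total le by move=> x y; rewrite /le; lia.
have le_tr : transitive le by move=> y x z; rewrite /le; lia.
have le_refl : reflexive le by move=> x; rewrite /le; lia.
pose vs := sort le (enum A).
have vsP x : x \in vs by rewrite mem_sort mem_enum.
have index_le x y : index x vs <= index y vs -> le x y.
  by apply: sorted_leq_index => //; exact: sort_sorted.
have K_le (C : {set A}) x y : C \in Fc_chain A -> y \in C -> K x <= K y ->
    x \in C.
  move=> CC yC; apply: contraTT => xC; rewrite -ltnNge; apply: proper_card.
  apply/properP; split.
    apply/subsetP => D; rewrite !inE => /andP[DC yD]; rewrite DC /=.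
    case: (chainI _ _ CC DC) => CD; first by rewrite (subsetP CD) in yD.
    by apply: contra xC; exact: (subsetP CD).
  by exists C; rewrite !inE CC ?yC.
have le_index x y : fan_le x y -> index x vs <= index y vs.
  move=> xy; have [-> //|nxy] := eqVneq x y.
  rewrite leqNgt; apply/negP => /ltnW/index_le.
  have Kxy : K x <= K y.
    apply: subset_leq_card; apply/subsetP => C; rewrite !inE => /andP[CC xC].
    by rewrite CC /=; apply: contra xC; apply: chainD CC _ _ xy.
  have hxy : ht x < ht y.
    rewrite ltnNge; apply/negP => /(fan_le_ht_eq parP xy) E.
    by rewrite E eqxx in nxy.
  by rewrite /le; lia.
have initial (C : {set A}) x y : C \in Fc_chain A -> y \in C ->
    index x vs <= index y vs -> x \in C.
  move=> CC yC /index_le; rewrite /le => H; apply: (K_le C x y) => //; lia.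
exists vs; split=> //; first by rewrite sort_uniq enum_uniq.
move=> P; split=> [PC|[P0 HP]]; first split.
- exact: chain0.
- by move=> x y; exact: initial.
have PD : down_closed P by move=> x y /le_index xy yP; exact: HP yP xy.
have comparable (C : {set A}) : C \in Fc_chain A -> C \subset P \/ P \subset C.
  move=> CC; case: (boolP (C \subset P)) => [|/subsetPn[x xC xP]]; first by left.
  right; apply/subsetP => y yP; apply: initial CC xC _.
  by rewrite leqNgt; apply: contra xP => /ltnW; exact: HP.
apply: chainM => //; split; first split.
- by move=> C; rewrite in_setU1 => /orP[/eqP->|/chain0].
- move=> C D; rewrite !in_setU1 => /orP[/eqP->|CC] /orP[/eqP->|DC].
  + by left.
  + by case: (comparable _ DC); [right | left].
  + exact: comparable.
  + exact: chainI.
- by move=> C; rewrite in_setU1 => /orP[/eqP->|/chainD].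
Qed.

Section Epimorphisms.
Variables (B A : fan) (parB : B -> B) (htB : B -> nat).
Variables (parA : A -> A) (htA : A -> nat).
Hypotheses (parBP : parent_map parB htB) (parAP : parent_map parA htA).

(** For a surjection that respects parents, edges lift: below any preimage of
    [x2] there is a last one on the way to the root that is still mapped to
    [x2], and its parent is mapped to the parent of [x2]. *)
Lemma fan_epimorphism_parent (f : B -> A) :
  (forall x, exists y, f y = x) ->
  (forall y, f (parB y) = f y \/ f (parB y) = parA (f y)) ->
  fan_epimorphism f.
Proof.
move=> fs fp; split=> // x1 x2; split; last first.
  move=> [y1 [y2 [<- <-]]] /(fan_relP parBP)[->|->]; first by left.
  by apply/(fan_relP parAP).
move/(fan_relP parAP) => [->|->].
  by have [y <-] := fs x2; exists y, y; split=> //; left.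
have [y] := fs x2; move En : (htB y) => n.
have [->|x2r] := eqVneq x2 (fan_root A).
  by rewrite (par_root parAP) => yx; exists y, y; split=> //; left.
elim: n y En => [|n IH] y yn yx.
  have froot : f (fan_root B) = fan_root A.
    have [z] := fs (fan_root A).
    have : forall i, f z = fan_root A -> f (iter i parB z) = fan_root A.
      elim=> // i IHi /IHi E /=.
      by have [->|->] := fp (iter i parB z); rewrite E ?(par_root parAP).
    by move=> /(_ (htB z)) H /H; rewrite (iter_ht parBP).
  by rewrite -yx (ht_eq0 parBP yn) froot eqxx in x2r.
have [E|E] := fp y; last first.
  exists (parB y), y; split; rewrite ?E ?yx //.
  by apply/(fan_relP parBP); right.
by apply: (IH (parB y)); rewrite ?E ?(ht_par parBP) ?yn.
Qed.

Lemma fan_epimorphism_par (f : B -> A) y : fan_epimorphism f ->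
  f (parB y) = f y \/ f (parB y) = parA (f y).
Proof.
case=> _ /(_ (f (parB y)) (f y)) [_ H]; apply/(fan_relP parAP); apply: H.
by exists (parB y), y; split=> //; apply/(fan_relP parBP); right.
Qed.

End Epimorphisms.

Section ChainEnum.
Variables (A : Fc) (vs : seq A).
Hypothesis vsP : chain_enum vs.

Lemma chain_enum_uniq : uniq vs. Proof. by case: vsP. Qed.
Lemma chain_enum_mem x : x \in vs. Proof. by case: vsP. Qed.
Lemma chain_enum_le (x y : A) : fan_le x y -> index x vs <= index y vs.
Proof. by case: vsP => _ _ H _; exact: H. Qed.
Lemma chain_enum_initial (P : {set A}) : P \in Fc_chain A <->
  P != set0 /\ forall x y, y \in P -> index x vs <= index y vs -> x \in P.
Proof. by case: vsP. Qed.

Lemma chain_enum_inj x y : index x vs = index y vs -> x = y.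
Proof.
by move=> E; rewrite -(nth_index x (chain_enum_mem x)) E nth_index ?chain_enum_mem.
Qed.

Lemma index_root : index (fan_root A) vs = 0.
Proof.
have [par [ht parP]] := parent_map_exists A.
have := chain_enum_le (fan_le_root parP (nth (fan_root A) vs 0)).
have s0 : 0 < size vs by have := chain_enum_mem (fan_root A); case: (vs).
by rewrite index_uniq ?chain_enum_uniq // leqn0 => /eqP.
Qed.

Lemma chain_root : [set fan_root A] \in Fc_chain A.
Proof.
apply/chain_enum_initial; split.
  by apply/set0Pn; exists (fan_root A); rewrite inE.
move=> x y; rewrite !inE => /eqP->; rewrite index_root leqn0 => /eqP E.
by apply/eqP/chain_enum_inj; rewrite index_root.
Qed.

End ChainEnum.

Lemma epimorphism_root (B A : Fc) (h : B -> A) : epimorphism h ->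
  h (fan_root B) = fan_root A.
Proof.
have [us usP] := chain_enum_exists B; have [vs vsP] := chain_enum_exists A.
case=> _ /(_ _ (chain_root usP)); rewrite imset_set1.
move/(chain_enum_initial vsP) => [_ H].
have := H (fan_root A) (h (fan_root B)).
by rewrite !inE (index_root vsP) => /(_ (eqxx _) (leq0n _))/eqP.
Qed.

(** The image of the initial segment ending at [x] is an initial segment that
    contains [h x], so all vertices of smaller index are values of [h] before
    [x]. *)
Lemma epimorphism_rigid (B A : Fc) (us : seq B) (vs : seq A) (h : B -> A) :
  chain_enum us -> chain_enum vs -> epimorphism h ->
  rigid 0 (size vs) [seq index (h x) vs | x <- us].
Proof.
move=> usP vsP [[hs _] hC]; apply: rigid_of_prev.
- by apply/allP => _ /mapP[x _ ->]; rewrite index_mem (chain_enum_mem vsP).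
- move=> j jv; have [x hx] := hs (nth (fan_root A) vs j).
  apply/mapP; exists x; first exact: (chain_enum_mem usP).
  by rewrite hx index_uniq // (chain_enum_uniq vsP).
move=> n i; rewrite size_map => nu; rewrite (nth_map (fan_root B)) // => ih.
set x := nth _ us n in ih.
have ux : index x us = n by rewrite index_uniq // (chain_enum_uniq usP).
have iv : i < size vs.
  by apply: leq_trans ih _; rewrite ltnW // index_mem (chain_enum_mem vsP).
set v := nth (fan_root A) vs i.
have vi : index v vs = i by rewrite index_uniq // (chain_enum_uniq vsP).
pose P := [set y : B | index y us <= n].
have : h @: P \in Fc_chain A.
  apply: hC; apply/(chain_enum_initial usP); split.
    by apply/set0Pn; exists x; rewrite inE ux.
  by move=> y z; rewrite !inE => zn yz; exact: leq_trans zn.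
case/(chain_enum_initial vsP) => _ /(_ v (h x)).
rewrite vi imset_f ?inE ?ux // => /(_ isT (ltnW ih))/imsetP[y].
rewrite inE leq_eqVlt => /orP[/eqP yn|yn] vy.
  have xy : y = x by apply: (chain_enum_inj usP); rewrite yn ux.
  by move: ih; rewrite -xy -vy vi ltnn.
rewrite -map_take -vi vy; apply: (map_f (fun z => index (h z) vs)).
by rewrite in_take // (chain_enum_mem usP).
Qed.

(** * Combs: fans with many branches of the same height *)

Section Comb.
Variables n m : nat.

(** [None] is the root and [Some (i, t)] the vertex of height [t.+1] on branch
    [i]. *)
Definition comb_vertex : Type := option ('I_n.+1 * 'I_m.+1).
HB.instance Definition _ := Finite.on comb_vertex.

Implicit Types x y z : comb_vertex.

Definition comb_par x : comb_vertex :=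
  if x is Some (i, t) then if val t is s.+1 then Some (i, inord s) else None
  else None.

Definition comb_ht x : nat := if x is Some (_, t) then t.+1 else 0.

Definition comb_edge : rel comb_vertex :=
  fun x y => [|| x == y, comb_par x == y | comb_par y == x].

Lemma comb_ht_par x : comb_ht (comb_par x) = (comb_ht x).-1.
Proof.
case: x => [[i [[|s] si]]|] //=; rewrite inordK //; exact: ltnW.
Qed.

Lemma comb_ht_eq0 x : comb_ht x = 0 -> x = None.
Proof. by case: x => [[]|]. Qed.

Lemma comb_loops : reflexive comb_edge.
Proof. by move=> x; rewrite /comb_edge eqxx. Qed.

Lemma comb_sym : symmetric comb_edge.
Proof. by move=> x y; rewrite /comb_edge eq_sym [X in _ || X]orbC. Qed.

Lemma comb_connected x y : connect comb_edge x y.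
Proof.
have root_conn z : connect comb_edge z None.
  move Ek : (comb_ht z) => k; elim: k z Ek => [|k IH] z zk.
    by rewrite (comb_ht_eq0 zk) connect0.
  apply: connect_trans (IH (comb_par z) _); last by rewrite comb_ht_par zk.
  by apply: connect1; rewrite /comb_edge eqxx orbT.
apply: connect_trans (root_conn x) _.
by rewrite (sym_connect_sym comb_sym) root_conn.
Qed.

Lemma comb_edge_par x y : comb_edge x y -> y != x -> comb_ht y <= comb_ht x ->
  y = comb_par x.
Proof.
case/or3P => /eqP; [by move->; rewrite eqxx | by [] |].
move=> <-; have [->|y0] := eqVneq y None; first by rewrite eqxx.
rewrite comb_ht_par; case E : (comb_ht y) => [|k] /=; last by rewrite ltnn.
by rewrite (comb_ht_eq0 E) in y0.
Qed.

(** Both neighbours on a cycle of a vertex of maximal height are its parent, so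
    they coincide. *)
Lemma comb_acyclic (c : seq comb_vertex) :
  cycle comb_edge c -> uniq c -> size c <= 2.
Proof.
case: c => [//|x0 c0]; set c := x0 :: c0 => cc uc.
have [x xc xmax] : exists2 x, x \in c & forall y, y \in c ->
    comb_ht y <= comb_ht x.
  case: (@arg_maxnP _ x0 (mem c) comb_ht (mem_head _ _)) => x xc H.
  by exists x.
have [i s Es] := rot_to xc.
have : cycle comb_edge (x :: s) by rewrite -Es rot_cycle.
have : uniq (x :: s) by rewrite -Es rot_uniq.
have sub y : y \in x :: s -> comb_ht y <= comb_ht x.
  by rewrite -Es mem_rot; exact: xmax.
rewrite -(size_rot i) Es; case: s sub {Es} => [|y [|z s]] //= sub.
rewrite rcons_path => /and3P[xs ys _] /andP[exy /andP[_ ex]].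
have yx : y != x by apply: contraNneq xs => ->; exact: mem_head.
have lz : last z s \in z :: s := mem_last z s.
have lx : last z s != x by apply: contraNneq xs => <-; rewrite in_cons lz orbT.
have Ey : y = comb_par x.
  by apply: comb_edge_par => //; apply: sub; rewrite !in_cons eqxx orbT.
have El : last z s = comb_par x.
  apply: comb_edge_par => //; first by rewrite comb_sym; case/andP: ex.
  by apply: sub; rewrite in_cons in_cons lz !orbT.
by case/negP: ys; rewrite Ey -El.
Qed.

Lemma comb_degree x : x != None ->
  #|[set y | (y != x) && comb_edge x y]| <= 2.
Proof.
case: x => [[i t] _|//].
apply: (@leq_trans #|[set comb_par (Some (i, t)); Some (i, inord t.+1)]|);
  last by rewrite cards2; case: eqP.
apply: subset_leq_card; apply/subsetP => y; rewrite !inE => /andP[yx].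
case/or3P => [/eqP E|/eqP <-|/eqP]; [by rewrite E eqxx in yx|by rewrite eqxx|].
case: y yx => [[j [[|s] si]]|] //= _ [-> <-]; apply/orP; right; apply/eqP.
by congr (Some (_, _)); apply: val_inj; rewrite /= inordK // inordK // ltnW.
Qed.

Definition comb : fan := @Fan comb_vertex comb_edge None
  comb_loops comb_sym comb_connected comb_acyclic comb_degree.

Lemma comb_parent : @parent_map comb comb_par comb_ht.
Proof.
split=> // t t0; split; first by rewrite /= /comb_edge eqxx orbT.
rewrite (comb_ht_par t); case E : (comb_ht t) => //.
by rewrite (comb_ht_eq0 E) in t0.
Qed.

Lemma comb_iter k (i : 'I_n.+1) (t : 'I_m.+1) : iter k comb_par (Some (i, t)) =
  if k <= t then Some (i, inord (t - k)) else None.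
Proof.
elim: k => [|k IH]; first by rewrite /= subn0 inord_val.
rewrite iterS IH; case: (leqP k t) => kt; last by rewrite ltnNge (ltnW kt).
have tk : t - k < m.+1 by apply: leq_ltn_trans (leq_subr _ _) (ltn_ord t).
rewrite /= inordK // -subn_gt0 subnS; by case: (t - k).
Qed.

Lemma comb_leP (x y : comb) : fan_le x y <->
  if x is Some (i, s) then
    if y is Some (j, t) then (i == j) && (s <= t) else False
  else True.
Proof.
split=> [/(fan_leP comb_parent)[k ->]|].
  case: y => [[i t]|]; last first.
    by have -> : iter k comb_par None = None := iter_root comb_parent k.
  rewrite comb_iter; case: leqP => // kt; rewrite eqxx inordK ?leq_subr //.
  by apply: leq_ltn_trans (leq_subr _ _) (ltn_ord t).
case: x => [[i s]|] H; last exact: (fan_le_root comb_parent).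
case: y H => [[j t]|] // /andP[/eqP <- st].
apply/(fan_leP comb_parent); exists (t - s).
by rewrite comb_iter leq_subr subKn // inord_val.
Qed.

(** The position of a vertex when the branches are listed one after the other,
    each from the root upwards. *)
Definition comb_code (x : comb) : nat :=
  if x is Some (i, t) then (i * m.+1 + t).+1 else 0.

Lemma comb_code_le (x y : comb) : fan_le x y -> comb_code x <= comb_code y.
Proof.
move/comb_leP; case: x => [[i s]|] //; case: y => [[j t]|] // /andP[/eqP -> st].
by rewrite /= ltnS leq_add2l.
Qed.

Lemma comb_code_lt (i j : 'I_n.+1) (s t : 'I_m.+1) : i < j ->
  comb_code (Some (i, s)) < comb_code (Some (j, t)).
Proof.
move=> ij; rewrite /= ltnS; apply: (@leq_trans (i.+1 * m.+1)).
  by rewrite mulSn addnC ltn_add2r.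
by apply: leq_trans (leq_addr _ _); rewrite leq_mul2r ij orbT.
Qed.

Lemma comb_code_inj : injective comb_code.
Proof.
move=> [[i s]|] [[j t]|] //= [E].
case: (ltngtP i j) => ij; last 1 first.
- move/eqP: E; rewrite ij eqn_add2l => /eqP/val_inj->; by rewrite (val_inj ij).
- by have := comb_code_lt s t ij; rewrite /= E ltnn.
- by have := comb_code_lt t s ij; rewrite /= E ltnn.
Qed.

Definition comb_segment (y : comb) : {set comb} :=
  [set x | comb_code x <= comb_code y].

Definition comb_chain : {set {set comb}} := [set comb_segment y | y : comb].

Lemma comb_chain_initial (C : {set comb}) x y : C \in comb_chain -> y \in C ->
  comb_code x <= comb_code y -> x \in C.
Proof. by case/imsetP => z _ ->; rewrite !inE => yz xy; exact: leq_trans yz. Qed.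

(** If [D] is comparable with all segments and [x] is its last vertex, every
    proper segment of that of [x] must lie inside [D]. *)
Lemma comb_chain_maximal : down_closed_maximal_chain comb_chain.
Proof.
split; first split; first split.
- by move=> _ /imsetP[y _ ->]; apply/set0Pn; exists y; rewrite inE.
- move=> _ _ /imsetP[x _ ->] /imsetP[y _ ->].
  case: (leqP (comb_code x) (comb_code y)) => xy; [left | right];
    apply/subsetP => z; rewrite !inE => zx; apply: leq_trans zx _ => //.
  exact: ltnW.
- by move=> C CC x y /comb_code_le xy yC; exact: comb_chain_initial CC yC xy.
move=> D /set0Pn[x0 x0D] _ [[_ cmp] _].
have [x xD xmax] : exists2 x, x \in D & forall y, y \in D ->
    comb_code y <= comb_code x.
  by case: (@arg_maxnP _ x0 (mem D) comb_code x0D) => x xD H; exists x.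
suff -> : D = comb_segment x by apply: imset_f.
apply/eqP; rewrite eqEsubset; apply/andP; split; apply/subsetP => y.
  by rewrite inE => /xmax.
rewrite inE leq_eqVlt => /orP[/eqP/comb_code_inj->//|yx].
have [] := cmp D (comb_segment y); rewrite ?setU11 //.
- by rewrite in_setU1 imset_f ?orbT.
- by move/subsetP/(_ x xD); rewrite inE leqNgt yx.
- by move/subsetP; apply; rewrite inE.
Qed.

Definition comb_branch (i : 'I_n.+1) : {set comb} :=
  None |: [set (Some (i, t) : comb) | t : 'I_m.+1].

Lemma mem_comb_branch i (x : comb) :
  (x \in comb_branch i) = if x is Some (j, _) then j == i else true.
Proof.
rewrite in_setU1; case: x => [[j t]|] //=.
by apply/imsetP/eqP => [[s _ [-> _]]|->] //; exists t.
Qed.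

Lemma comb_branchP (b : {set comb}) :
  branch b <-> exists i, b = comb_branch i.
Proof.
have lin i : linearly_ordered (comb_branch i).
  move=> [[j s]|] [[k t]|]; rewrite !mem_comb_branch => xb yb.
  - move: xb yb => /eqP-> /eqP->; case: (leqP s t) => st; [left | right]; apply/comb_leP.
      by rewrite eqxx.
    by rewrite eqxx ltnW.
  - by right; apply/comb_leP.
  - by left; apply/comb_leP.
  - by left; apply/comb_leP.
have sub (c : {set comb}) i t : linearly_ordered c -> (Some (i, t) : comb) \in c ->
    c \subset comb_branch i.
  move=> lc tc; apply/subsetP => -[[j s]|] sc; rewrite mem_comb_branch //.
  by have [/comb_leP/andP[]|/comb_leP/andP[]] := lc _ _ sc tc; rewrite // eq_sym.
split=> [[lb bmax]|[i ->]].
  have [i bi] : exists i, b \subset comb_branch i.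
    case: (boolP [exists it : 'I_n.+1 * 'I_m.+1, (Some it : comb) \in b]).
      by case/existsP => -[i t] tb; exists i; exact: sub lb tb.
    rewrite negb_exists => /forallP H; exists ord0; apply/subsetP => -[it itb|_].
      by have := H it; rewrite itb.
    by rewrite mem_comb_branch.
  by exists i; apply/esym/bmax.
split=> // c lc ic; apply/eqP; rewrite eqEsubset ic andbT.
by apply: (sub c i ord0) => //; apply: (subsetP ic); rewrite mem_comb_branch.
Qed.

Lemma comb_canonical : canonical_chain comb_chain.
Proof.
have bi : injective comb_branch.
  move=> i j /setP/(_ (Some (i, ord0))).
  by rewrite !mem_comb_branch eqxx => /esym/eqP.
exists [seq comb_branch i | i <- enum 'I_n.+1]; split.
- by rewrite map_inj_uniq ?enum_uniq.
- move=> b; rewrite comb_branchP; split=> [/mapP[i _ ->]|[i ->]]; first by exists i.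
  by apply: map_f; rewrite mem_enum.
move=> C CC i j ij; rewrite size_map size_enum_ord => jn.
rewrite !(nth_map ord0) -?enumT ?size_enum_ord ?(ltn_trans ij jn) //.
case/set0Pn => -[[k t]|]; rewrite !inE ?andbF // => /andP[tC].
rewrite -[_ || _]in_setU1 -/(comb_branch _) mem_comb_branch => /eqP Ek.
apply/subsetP => -[[l s]|] sb; apply: comb_chain_initial CC tC _ => //.
move: sb; rewrite mem_comb_branch => /eqP El.
apply: ltnW; apply: comb_code_lt.
by rewrite El Ek !nth_enum_ord // (ltn_trans ij).
Qed.

Lemma comb_height (b b' : {set comb}) : branch b -> branch b' ->
  height b = height b'.
Proof.
have card i : #|comb_branch i| = m.+2.
  rewrite cardsU1 card_imset ?card_ord; last by move=> s t [].
  by case: imsetP => // -[].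
by move=> /comb_branchP[i ->] /comb_branchP[j ->]; rewrite /height !card.
Qed.

Definition comb_Fcc : Fcc :=
  @MkFcc (@MkFc comb comb_chain comb_chain_maximal) comb_canonical comb_height.

End Comb.

(** * Walks towards a vertex and their thinning *)

Lemma sorted_count_leq (Y : seq nat) t c : sorted ltn Y -> c < size Y ->
  (nth 0 Y c <= t) = (c < count (fun y => y <= t) Y).
Proof.
elim: Y c => [|y Y IH] c //= pY cY.
have tail_gt : t < y -> count (fun z => z <= t) Y = 0.
  move=> ty; apply/eqP; rewrite -leqn0 leqNgt -has_count; apply/hasPn => z zY.
  rewrite -ltnNge; apply: ltn_trans ty _.
  by apply: (allP (order_path_min ltn_trans pY)).
case: (leqP y t) => yt /=; last first.
  rewrite tail_gt // ltn0; case: c cY => [|c] cY /=; first by rewrite leqNgt yt.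
  apply/negbTE; rewrite -ltnNge; apply: ltn_trans yt _.
  by apply: (allP (order_path_min ltn_trans pY)); apply: mem_nth.
case: c cY => [|c] cY /=; first by rewrite yt.
by rewrite add1n ltnS IH // (path_sorted pY).
Qed.

Lemma count_iota_lt (D : pred nat) n c :
  count (fun i => (i < c) && D i) (iota 0 n) = count D (iota 0 (minn n c)).
Proof.
have iotaS k : iota 0 k.+1 = rcons (iota 0 k) k by rewrite -addn1 iotaD cats1.
elim: n => [|n IH]; first by rewrite min0n.
rewrite iotaS -cats1 count_cat IH /= addn0.
case: (ltnP n c) => nc.
  by rewrite !(minn_idPl _) ?(ltnW nc) // iotaS -cats1 count_cat /= addn0.
by rewrite !(minn_idPr _) ?addn0 // leqW.
Qed.

(** The walk [f] climbs from the root, standing still at some steps.  It is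
    determined by its end and by the number of jumps made so far. *)
Section Thinning.
Variables (S : fan) (par : S -> S) (ht : S -> nat).
Hypothesis parP : parent_map par ht.
Variable f : nat -> S.
Hypothesis f0 : f 0 = fan_root S.
Hypothesis f_step : forall c, f c = f c.+1 \/ f c = par (f c.+1).

Let jump c := f c.+1 != f c.

Lemma ht_count_jumps c : ht (f c) = count jump (iota 0 c).
Proof.
elim: c => [|c IH]; first by rewrite f0 (ht_root parP).
rewrite -[in RHS]addn1 iotaD count_cat -IH /= add0n addn0 /jump.
case: eqP => [->|]; first by rewrite addn0.
have [->//|E] := f_step c; rewrite E (ht_par parP) => neq /=.
rewrite addn1 prednK // lt0n; apply/eqP => h0; case: neq.
by rewrite (ht_eq0 parP h0) (par_root parP).
Qed.

Lemma anc_ht_walk c d : anc par ht (f (c + d)) (ht (f c)) = f c.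
Proof.
suff [j ->] : exists j, f c = iter j par (f (c + d)) by apply: anc_ht_iter.
elim: d => [|d [j IH]]; first by exists 0; rewrite addn0.
rewrite addnS; have [E|E] := f_step (c + d); first by exists j; rewrite -E.
by exists j.+1; rewrite iterSr -E.
Qed.

(** Walking along [f] at the times in [Y] is the same as climbing straight to
    the end of [f] at those times at which [f] jumps.  The set [X] of these
    times is padded to the prescribed size [k] with times after the walk has
    ended, when further steps have no effect. *)
Lemma thin_walk n k Y : (forall c, f (n + c) = f n) -> ht (f n) <= k ->
  sorted ltn Y -> n + k <= size Y ->
  exists X, [/\ subseq X Y, size X = k & forall t : nat,
    f (count (fun y => y <= t) Y) =
    anc par ht (f n) (count (fun y => y <= t) X)].
Proof.
move=> fn hk sY nkY.
pose I := [seq c <- iota 0 n | jump c] ++ iota n (k - ht (f n)).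
have sI : subseq I (iota 0 (size Y)).
  rewrite -(subnKC nkY) -addnA iotaD add0n /I.
  apply: cat_subseq; first exact: filter_subseq.
  have -> : k + (size Y - (n + k)) = (k - ht (f n)) + (ht (f n) + (size Y - (n + k))).
    by rewrite addnA subnK.
  by rewrite iotaD; exact: prefix_subseq.
exists (map (nth 0 Y) I); split.
- by have := map_subseq (nth 0 Y) sI; rewrite map_nth_iota0 // take_size.
- by rewrite size_map size_cat size_filter size_iota -ht_count_jumps subnKC.
move=> t; set q := count _ Y; rewrite count_map.
have -> : count (preim (nth 0 Y) (fun y => y <= t)) I = count (fun c => c < q) I.
  apply: eq_in_count => c /(mem_subseq sI); rewrite mem_iota /= add0n => cY.
  exact: sorted_count_leq.
rewrite count_cat count_filter count_iota_lt -ht_count_jumps.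
case: (leqP n q) => nq.
  rewrite -(subnKC nq) fn anc_id //.
  by rewrite subnKC // leq_addr.
have -> : count (fun c => c < q) (iota n (k - ht (f n))) = 0.
  apply/eqP; rewrite -leqn0 leqNgt -has_count; apply/hasPn => c.
  by rewrite mem_iota -leqNgt => /andP[nc _]; exact: leq_trans (ltnW nq) nc.
by rewrite addn0 -{1}(subnKC (ltnW nq)) anc_ht_walk.
Qed.

End Thinning.

(** * Epimorphisms from combs given by a word and sets of times *)

Section CombMap.
Variables (n m : nat) (A : fan) (par : A -> A) (ht : A -> nat) (vs : seq A).

Definition comb_map (w : seq nat) (Xs : seq (seq nat)) : comb n m -> A :=
  fun x => if x is Some (i, t) then
    anc par ht (nth (fan_root A) vs (nth 0 w i))
      (count (fun s => s <= t) (nth [::] Xs i))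
  else fan_root A.

End CombMap.

Section CombMapEpi.
Variables (n m : nat) (A : Fc) (par : A -> A) (ht : A -> nat) (vs : seq A).
Hypotheses (parP : parent_map par ht) (vsP : chain_enum vs).
Variables (w : seq nat) (Xs : seq (seq nat)).
Hypotheses (wsize : size w = n.+1) (wrg : rigid 0 (size vs) w).
Hypothesis Xs_times : forall i, i < n.+1 ->
  uniq (nth [::] Xs i) && below m.+1 (nth [::] Xs i).
Hypothesis Xs_size : forall i x, i < n.+1 -> ht x <= size (nth [::] Xs i).

Local Notation g := (@comb_map n m A par ht vs w Xs).

Lemma comb_map_top i : i < n.+1 -> exists y : comb n m,
  g y = nth (fan_root A) vs (nth 0 w i) /\
  forall (j : 'I_n.+1) t, i < j -> @comb_code n m y < @comb_code n m (Some (j, t)).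
Proof.
move=> ni; exists (Some (Ordinal ni, ord_max)); split.
  rewrite /comb_map anc_id //= -[X in _ <= X](_ : size (nth [::] Xs i) = _).
    exact: Xs_size.
  symmetry; apply/eqP; rewrite -all_count.
  by have /andP[_] := Xs_times ni.
by move=> j t ij; exact: comb_code_lt.
Qed.

(** Images of segments of the comb are initial segments: a vertex [x] of smaller
    index than a vertex of the image met on branch [i] has index below [w_i], so
    by rigidity it is the target of an earlier branch, all of which lies in the
    segment. *)
Lemma comb_map_epi : @epimorphism (comb_Fcc n m) A g.
Proof.
split.
  apply: (fan_epimorphism_parent (@comb_parent n m) parP).
    move=> x; have : index x vs \in w.
      by apply: (rigid_mem wrg); rewrite leq0n index_mem (chain_enum_mem vsP).
    rewrite -index_mem => iw; rewrite wsize in iw.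
    have [y [gy _]] := comb_map_top iw; exists y.
    rewrite gy nth_index ?nth_index ?(chain_enum_mem vsP) //.
    by rewrite -index_mem wsize.
  move=> [[i t]|]; last by left.
  have /andP[uX _] := Xs_times (ltn_ord i).
  set v := nth (fan_root A) vs (nth 0 w i).
  set X := nth [::] Xs i in uX.
  case: t => [[|t] tm].
    rewrite /= -/v -/X -(anc0 parP v).
    have : count (fun s => s <= 0) X <= 1.
      rewrite (eq_count (a2 := pred1 0)); last by move=> s; rewrite leqn0.
      by rewrite count_uniq_mem //; case: (_ \in _).
    case: (count _ X) => [|[|]] // _; first by left.
    exact: anc_step.
  rewrite /= -/v -/X inordK; last exact: ltnW.
  have -> : count (fun s => s <= t.+1) X = count (fun s => s <= t) X + (t.+1 \in X).
    rewrite -(count_uniq_mem _ uX) -count_predUI.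
    rewrite [X in _ + X](_ : _ = 0) ?addn0; last first.
      apply/eqP; rewrite -leqn0 leqNgt -has_count; apply/hasPn => s _ /=.
      by case: eqP => [->|]; rewrite ?ltnn ?andbF.
    by apply: eq_count => s /=; rewrite leq_eqVlt orbC ltnS.
  by case: (_ \in X); rewrite ?addn0 ?addn1; [exact: anc_step | left].
move=> C CC; apply/(chain_enum_initial vsP); split.
  case/imsetP: (CC) => y _ ->; apply/set0Pn; exists (g y).
  by apply: imset_f; rewrite inE.
move=> x _ /imsetP[y yC ->] xy.
have [-> |nxy] := eqVneq x (g y); first exact: imset_f.
have {}xy : index x vs < index (g y) vs.
  by rewrite ltn_neqAle xy andbT; apply: contra nxy => /eqP/(chain_enum_inj vsP)->.
case: y yC xy {nxy} => [[i t]|] yC; last by rewrite /= (index_root vsP).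
move=> xy; set v := nth (fan_root A) vs (nth 0 w i).
have wi : nth 0 w i < size vs.
  by apply: (allP (rigid_below wrg)); rewrite mem_nth ?wsize.
have xw : index x vs < nth 0 w i.
  apply: leq_trans xy _.
  rewrite -[X in _ <= X](index_uniq (fan_root A) wi (chain_enum_uniq vsP)).
  by apply: (chain_enum_le vsP); exact: (fan_le_anc parP).
have xi : index x vs \in take i w.
  by apply: rigid_prev wrg _ _ xw; rewrite ?wsize.
have xwm : index x vs \in w by apply: mem_take xi.
have ii : index (index x vs) w < i by rewrite -in_take.
have [z [gz zlt]] := comb_map_top (ltn_trans ii (ltn_ord i)).
have -> : x = g z by rewrite gz !nth_index ?(chain_enum_mem vsP).
by apply: imset_f; apply: comb_chain_initial CC yC _; apply/ltnW/zlt.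
Qed.

End CombMapEpi.

Lemma nth_reshape_subseq (sh : seq nat) (Y : seq nat) i :
  subseq (nth [::] (reshape sh Y) i) Y.
Proof.
elim: sh Y i => [|s sh IH] Y [|i] //=; rewrite ?sub0seq ?take_subseq //.
exact: subseq_trans (IH _ _) (drop_subseq _ _).
Qed.

Lemma subseq_flatten (Xs Ys : seq (seq nat)) : size Xs = size Ys ->
  (forall i, i < size Ys -> subseq (nth [::] Xs i) (nth [::] Ys i)) ->
  subseq (flatten Xs) (flatten Ys).
Proof.
elim: Ys Xs => [|Y Ys IH] [|X Xs] //= [sz] H.
apply: cat_subseq; first exact: (H 0).
by apply: IH => // i iY; exact: (H i.+1).
Qed.

Lemma epimorphism_ffun (B A : Fc) (f : B -> A) : epimorphism f ->
  `[< epimorphism [ffun x => f x] >].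
Proof.
move=> fe; apply/asboolP.
by rewrite (_ : ([ffun x => f x] : B -> A) = f) //; apply: funext => x; rewrite ffunE.
Qed.

Lemma reshape_nseq_nth a b (Y : seq nat) i : size Y = a * b -> i < a ->
  size (nth [::] (reshape (nseq a b) Y) i) = b.
Proof.
move=> Yab ia; have sh : shape (reshape (nseq a b) Y) = nseq a b.
  by apply: reshapeKl; rewrite sumn_nseq Yab mulnC.
have -> : size (nth [::] (reshape (nseq a b) Y) i) = nth 0 (nseq a b) i.
  by rewrite -{2}sh (nth_map [::]) // size_reshape size_nseq.
by rewrite nth_nseq ia.
Qed.

Section Composition.
Variables (S T : Fc) (parS : S -> S) (htS : S -> nat) (vs : seq S).
Variables (parT : T -> T) (htT : T -> nat) (us : seq T).
Hypotheses (parSP : parent_map parS htS) (vsP : chain_enum vs).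
Hypotheses (parTP : parent_map parT htT) (usP : chain_enum us).
Variables (k q : nat).
Hypotheses (k_ht : forall x, htS x <= k) (q_ht : forall x, htT x <= q).

(** The root is the constant letter 0, so an epimorphism from [T] to [S] is the
    filling of words over [T] by a rigid word over [S] with one constant. *)
Lemma epimorphism_word (h : T -> S) : epimorphism h -> exists w : seq nat,
  [/\ size w = (size us).-1, rigid 1 (size vs) w & forall j, j < size us ->
      nth (fan_root S) vs (fill1 1 w j) = h (nth (fan_root T) us j)].
Proof.
move=> he; have := epimorphism_rigid usP vsP he.
have := index_root usP; case Eus : us => [|r us'].
  by have := chain_enum_mem usP (fan_root T); rewrite Eus.
move=> /=; case: eqP => // rr _.
rewrite rr (epimorphism_root he) (index_root vsP) max0n => hr.
exists [seq index (h x) vs | x <- us']; split=> //; first exact: size_map.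
move=> [|j] /= jus.
  rewrite /fill1 /= -rr rr -[X in nth _ _ X](index_root vsP) nth_index.
    by rewrite (epimorphism_root he).
  exact: (chain_enum_mem vsP).
by rewrite /fill1 /= subn1 /= (nth_map (fan_root T)) // nth_index ?(chain_enum_mem vsP).
Qed.

(** A block of [Y] has [q + k] times: at most [q] are needed to climb in [T],
    and the [k] last ones are available as padding in [thin_walk]. *)
Lemma comb_map_comp n m (h : T -> S) w u Y : epimorphism h ->
  (forall j, j < size us ->
    nth (fan_root S) vs (fill1 1 w j) = h (nth (fan_root T) us j)) ->
  size u = n -> below (size us) u -> sorted ltn Y -> size Y = n.+1 * (q + k) ->
  exists X, [/\ subseq X Y, size X = n.+1 * k & forall x : comb n m,
    h (comb_map parT htT us (0 :: u) (reshape (nseq n.+1 (q + k)) Y) x) =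
    comb_map parS htS vs (0 :: fill 1 w u) (reshape (nseq n.+1 k) X) x].
Proof.
move=> he wh un ub sY Ysize; set Ys := reshape _ Y.
pose v i := nth (fan_root T) us (nth 0 (0 :: u) i).
have hroot := epimorphism_root he.
have hpar := fan_epimorphism_par parTP parSP _ (proj1 he).
have thin i : exists Xi, i < n.+1 ->
    [/\ subseq Xi (nth [::] Ys i), size Xi = k & forall t : nat,
      h (anc parT htT (v i) (count (fun y => y <= t) (nth [::] Ys i))) =
      anc parS htS (h (v i)) (count (fun y => y <= t) Xi)].
  case: (ltnP i n.+1) => ni; last by exists [::].
  have := @thin_walk S parS htS parSP (fun c => h (anc parT htT (v i) c)) _ _
    (htT (v i)) k (nth [::] Ys i).
  case=> //.
  - by rewrite (anc0 parTP).
  - move=> c; have [->|->] := anc_step parT htT (v i) c; [by left | exact: hpar].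
  - by move=> c; rewrite !anc_id // leq_addr.
  - by apply: subseq_sorted sY; [exact: ltn_trans | exact: nth_reshape_subseq].
  - by rewrite reshape_nseq_nth // leq_add2r.
  move=> Xi [X1 X2 X3]; exists Xi => _; split=> // t.
  by rewrite X3 (@anc_id _ _ htT (v i) (htT (v i))).
have [Xf Xfp] := choice thin.
have Xn i : i < n.+1 -> nth [::] (mkseq Xf n.+1) i = Xf i.
  by move=> ni; rewrite nth_mkseq.
have shX : shape (mkseq Xf n.+1) = nseq n.+1 k.
  apply: (@eq_from_nth _ 0); rewrite !size_map ?size_iota ?size_nseq // => i ni.
  by rewrite (nth_map [::]) ?size_mkseq // Xn // nth_nseq ni; have [] := Xfp i ni.
exists (flatten (mkseq Xf n.+1)); split.
- rewrite -(@reshapeKr _ (nseq n.+1 (q + k)) Y) ?sumn_nseq ?Ysize 1?mulnC //.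
  apply: subseq_flatten; rewrite ?size_mkseq size_reshape size_nseq // => i ni.
  by rewrite Xn //; have [] := Xfp i ni.
- by rewrite size_flatten shX sumn_nseq mulnC.
rewrite -shX flattenK => -[[i t]|] //=.
rewrite Xn //; have [_ _ ->] := Xfp i (ltn_ord i).
have -> : 0 :: fill 1 w u = fill 1 w (0 :: u) by [].
have iu : i < size (0 :: u) by rewrite /= un.
rewrite (nth_map 0) // wh //.
apply: (allP (_ : below (size us) (0 :: u))); last exact: mem_nth.
by rewrite /= ub andbT; have := chain_enum_mem usP (fan_root T); case: (us).
Qed.

End Composition.

(** * The Ramsey property *)

Theorem theorem4p7 (r : nat) (hr : 2 <= r) (S T : Fcc)
    (hST : inhabited (epi T S)) :
  exists U : Fcc,
    forall e : epi U S -> 'I_r,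
      exists g : epi U T,
        exists c : 'I_r, forall h : epi T S, e (epi_comp h g) = c.
Proof.
have [parS [htS parSP]] := parent_map_exists S.
have [parT [htT parTP]] := parent_map_exists T.
have [vs vsP] := chain_enum_exists S; have [us usP] := chain_enum_exists T.
pose k := \max_(x : S) htS x; pose q := \max_(x : T) htT x.
have k_ht x : htS x <= k by exact: leq_bigmax.
have q_ht x : htT x <= q by exact: leq_bigmax.
have vs0 : 0 < size vs by have := chain_enum_mem vsP (fan_root S); case: (vs).
have us0 : 0 < size us by have := chain_enum_mem usP (fan_root T); case: (us).
have [n Hn] := @graham_rothschild 0 (size vs).-1 (size us).-1 (option 'I_r).
have [D HD] := vector_colouring (size vs) n.+1 (option 'I_r).
have [m Hm] := ramsey_subseq (n.+1 * k) (n.+1 * (q + k)) D.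
exists (comb_Fcc n m) => e.
(* The colour is extended to all pairs of times and words by a value None
   where the associated map is not an epimorphism. *)
pose E X w := omap e (insub [ffun x : comb_Fcc n m =>
  @comb_map n m S parS htS vs w (reshape (nseq n.+1 k) X) x]).
have [f Hf] := HD E; have [Y [Ysize sY Ym HY]] := Hm f.
pose X0 := take (n.+1 * k) Y.
(* The comb has one branch more than u has letters; its first branch is sent
   to the root. *)
have [u [un ur Hu]] := Hn (fun w => E X0 (0 :: w)).
rewrite !add1n !prednK // in ur Hu.
have X0Y : subseq X0 Y by exact: take_subseq.
have X0size : size X0 = n.+1 * k.
  by rewrite size_takel // Ysize leq_mul2l leq_addl orbT.
pose g := @comb_map n m T parT htT us (0 :: u) (reshape (nseq n.+1 (q + k)) Y).
have gepi : @epimorphism (comb_Fcc n m) T g.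
  apply: comb_map_epi => //; first by rewrite /= un.
  - move=> i _; have sYi := nth_reshape_subseq (nseq n.+1 (q + k)) Y i.
    apply/andP; split.
      exact: subseq_uniq sYi (sorted_uniq ltn_trans ltnn sY).
    by apply/allP => y /(mem_subseq sYi)/(allP Ym) /= /ltnW.
  - move=> i x ni; rewrite reshape_nseq_nth //.
    exact: leq_trans (q_ht x) (leq_addr _ _).
exists (Epi (epimorphism_ffun gepi)); set g' := Epi _.
(* The times have been made irrelevant, so those of X0 represent them. *)
have colour h : exists w, [/\ size w = (size us).-1, rigid 1 (size vs) w &
    Some (e (epi_comp h g')) = E X0 (0 :: fill 1 w u)].
  have /asboolP he := epiP h.
  have [w [wsize wr wh]] := epimorphism_word vsP usP he.
  have := @comb_map_comp S T parS htS vs parT htT us parSP parTP usP k q k_ht q_ht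
    n m h w u Y he wh un (rigid_below ur) sY Ysize.
  case=> X [XY Xsize hX]; exists w; split=> //.
  have -> : Some (e (epi_comp h g')) = E X (0 :: fill 1 w u).
    transitivity (omap e (insub (val (epi_comp h g')))); first by rewrite valK.
    congr (omap e (insub _)).
    by apply/ffunP => x; rewrite !ffunE hX.
  apply: Hf.
  - exact: HY.
  - rewrite /= vs0; apply: below_fill; rewrite ?wsize ?add1n ?prednK //.
      exact: rigid_below ur.
    exact: rigid_below wr.
  - by rewrite /= size_fill un.
case: hST => h0; exists (e (epi_comp h0 g')) => h; apply: Some_inj.
have [w [ws wr ->]] := colour h; have [w0 [w0s w0r ->]] := colour h0.
exact: Hu.
Qed.
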